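(* Let $H=\{x_i\}_{i\in I(H)}$ be any (discrete, not necessarily hermitian) hypergroup. Then there exist an open quantum random walk $\mathcal{M}$ on a distance set and an initial state $\rho^{(0)}$ such that $\mathcal{M}$ with the initial state $\rho^{(0)}$ produces a hypergroup $H_{\mathcal{M}}$ whose structure constants coincide with those of $H$; hence $H_{\mathcal{M}}$ is isomorphic to $H$.
   Context: Notation: $\mathbb{N}=\{1,2,\dots\}$, $\mathbb{N}_0=\mathbb{N}\cup\{0\}$. For a set $S$, $\mathbb{C}S$ is the free complex vector space on $S$. For a Hilbert space $\mathcal{L}$, $\mathcal{B}_1(\mathcal{L})$ is the space of trace class operators and $\mathcal{B}_1(\mathcal{L})_{+,1}=\{X\in\mathcal{B}_1(\mathcal{L}) : X\ge 0,\ \mathrm{Tr}(X)=1\}$ is the set of states. $|\xi\rangle\langle\eta|$ is the rank one operator $\zeta\mapsto\langle\eta,\zeta\rangle\xi$. Hypergroups. Let $H=\{x_i\}_{i\in I(H)}$ be a countable set indexed by $I(H)$, where $I(H)$ is $\{0,\dots,N\}$ for some $N\in\mathbb{N}$ or $\mathbb{N}_0$. Given a binary operation $\circ$ and a map $*$ on $\mathbb{C}H$, the triple $(H,\circ,* )$ is a (discrete) hypergroup if: (1) $*|_H$ maps onto $H$, and $(\mathbb{C}H,\circ,* )$ is an (associative) $*$-algebra with unit $x_0$; (2) for all $i,j\in I(H)$ there are $m\in I(H)$ and $q_{i,j}^0,\dots,q_{i,j}^m\ge 0$ with $\sum_{k=0}^m q_{i,j}^k=1$ and $x_i\circ x_j=\sum_{k=0}^m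 q_{i,j}^k x_k$ (put $q_{i,j}^k=0$ for $k>m$); (3) for all $i,j\in I(H)$, $q_{i,j}^0\ne 0$ if and only if $x_i=x_j^*$. The numbers $\{q_{i,j}^k\}_{i,j,k\in I(H)}$ are the structure constants of $H$. It is hermitian if $*|_H$ is the identity. An isomorphism of hypergroups $H\to H'$ is a bijection $H\to H'$ that extends to a $*$-homomorphism $\mathbb{C}H\to\mathbb{C}H'$. Open quantum random walks on distance sets. A distance set $\mathcal{D}$ is either $\{0,\dots,N\}$ for some $N\in\mathbb{N}$ or $\mathbb{N}_0$. Let $\mathcal{K}$ be a Hilbert space with an orthonormal basis $\{|n\rangle\}_{n\in\mathcal{D}}$ and $\mathcal{H}$ a separable Hilbert space. Let $\{B_{i,j;k}\}_{i,j,k\in\mathcal{D}}$ be bounded operators on $\mathcal{H}$ with $\sum_{i\in\mathcal{D}}B_{i,j;k}^*B_{i,j;k}=\mathbf{1}$ (strong operator topology) for all $j,k\in\mathcal{D}$. Put $M_{i,j;k}=B_{i,j;k}\otimes|i\rangle\langle j|$ on $\mathcal{H}\otimes\mathcal{K}$. For $k\in\mathcal{D}$ the map $\mathcal{M}_k(X)=\sum_{i,j\in\mathcal{D}}M_{i,j;k}XM_{i,j;k}^*$ (convergence in trace norm for positive $X\in\mathcal{B}_1(\mathcal{H}\otimes\mathcal{K})$) extends linearly to $\mathcal{B}_1(\mathcal{H}\otimes\mathcal{K})$. The family $\mathcal{M}=\{\mathcal{M}_k\}_{k\in\mathcal{D}}$ is called an open quantum random walk (OQRW) on $\mathcal{D}$.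 Each $\mathcal{M}_k$ maps states to states, and if $\rho=\sum_{i\in\mathcal{D}}\rho_i\otimes|i\rangle\langle i|$ is a state then $\mathcal{M}_k(\rho)=\sum_{i\in\mathcal{D}}\bigl(\sum_{j\in\mathcal{D}}B_{i,j;k}\rho_jB_{i,j;k}^*\bigr)\otimes|i\rangle\langle i|$. Hypergroup produced by an OQRW. Let $\mathcal{M}$ be an OQRW on $\mathcal{D}$ and $\rho^{(0)}=\sum_{i\in\mathcal{D}}\rho^{(0)}_i\otimes|i\rangle\langle i|\in\mathcal{B}_1(\mathcal{H}\otimes\mathcal{K})_{+,1}$ an initial state. For $k,l\in\mathcal{D}$ write $\mathcal{M}_k(\mathcal{M}_l(\rho^{(0)}))=\sum_{m\in\mathcal{D}}\rho_m^{(2;(l,k))}\otimes|m\rangle\langle m|$ and set $\tilde p_{k,l}^m=\mathrm{Tr}(\rho_m^{(2;(l,k))})$. Assume $\{m\in\mathcal{D}:\tilde p_{k,l}^m\ne 0\}$ is finite for all $k,l\in\mathcal{D}$. On the free vector space with basis $H_{\mathcal{M}}=\{z_i\}_{i\in\mathcal{D}}$ define the bilinear product $z_i\circ z_j=\sum_{k\in\mathcal{D}}\tilde p_{i,j}^k z_k$. If $(H_{\mathcal{M}},\circ,* )$ is a hypergroup for some involution $*$ on $\mathbb{C}H_{\mathcal{M}}$, one says that $\mathcal{M}$ with the initial state $\rho^{(0)}$ produces the hypergroup $H_{\mathcal{M}}$. *)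

(* Defs.v *)
From HB Require Import structures.
From mathcomp Require Import all_boot all_order all_algebra finmap complex.
From mathcomp Require Import all_classical all_reals all_analysis.
From mathcomp.analysis.showcase Require Import summability.
(* The notations of monalg clash with those of MathComp-Analysis, hence only
   its canonical instances are imported and its constants are qualified. *)
From mathcomp Require monalg.
Import (canonicals) monalg.

Set Implicit Arguments.
Unset Strict Implicit.
Unset Printing Implicit Defensive.
Import Order.TTheory GRing.Theory Num.Theory numFieldNormedType.Exports.
Local Open Scope classical_set_scope.
Local Open Scope ring_scope.
Local Open Scope complex_scope.

Definition freevs (R : realType) (X : choiceType) : lmodType R[i] :=
  monalg.malg X R[i].

Definition bas (R : realType) (X : choiceType) (x : X) : freevs R X :=
  monalg.mkmalgU x (1 : R[i]).

Definition coef (R : realType) (X : choiceType) (x : X) (u : freevs R X) :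
    R[i] :=
  monalg.mcoeff x u.

Record distance_set := DistanceSet {
  dset :> set nat ;
  dsetP : dset = setT \/ exists2 N, (0 < N)%N & dset = [set n | (n <= N)%N] }.

Lemma dset0 (D : distance_set) : 0%N \in (D : set nat).
Proof. by rewrite inE; case: (dsetP D) => [|[N _]] ->. Qed.

Definition dzero (D : distance_set) : D := exist _ 0%N (dset0 D).

Record star_algebra (R : realType) (A : lmodType R[i])
    (mul : A -> A -> A) (star : A -> A) (one : A) : Prop := StarAlgebra {
  sa_linear_r : forall u, linear (mul u) ;
  sa_linear_l : forall v, linear (mul^~ v) ;
  sa_assoc : associative mul ;
  sa_one_l : left_id one mul ;
  sa_one_r : right_id one mul ;
  sa_conj : forall (c : R[i]) u v,
    star (c *: u + v) = Num.conj c *: star u + star v ;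
  sa_invol : involutive star ;
  sa_antimul : forall u v, star (mul u v) = mul (star v) (star u) }.

(* The coefficient of [x k] in the product of [x i] and [x j].  It is
   complex-valued because the ambient space is complex; in a hypergroup it is
   a nonnegative real by [hg_convex]. *)
Definition structure_constant (R : realType) (D : distance_set)
    (X : choiceType) (x : D -> X) (mul : freevs R X -> freevs R X -> freevs R X)
    (i j k : D) : R[i] :=
  coef (x k) (mul (bas R (x i)) (bas R (x j))).

Record is_hypergroup (R : realType) (D : distance_set) (X : choiceType)
    (x : D -> X) (mul : freevs R X -> freevs R X -> freevs R X)
    (star : freevs R X -> freevs R X) : Prop := IsHypergroup {
  hg_index : bijective x ;
  hg_star_onto : star @` range (@bas R X) = range (@bas R X) ;
  hg_algebra : star_algebra mul star (bas R (x (dzero D))) ;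
  hg_convex : forall i j : D, exists (m : D) (q : D -> R),
    [/\ forall k, 0 <= q k,
        \sum_(k \in [set k : D | (val k <= val m)%N]) q k = 1 &
        mul (bas R (x i)) (bas R (x j)) =
          \sum_(k \in [set k : D | (val k <= val m)%N])
            (q k)%:C *: bas R (x k)] ;
  hg_inverse : forall i j : D,
    structure_constant x mul i j (dzero D) != 0
    <-> bas R (x i) = star (bas R (x j)) }.

Definition hypergroup_isomorphism (R : realType) (X Y : choiceType)
    (mulX : freevs R X -> freevs R X -> freevs R X)
    (starX : freevs R X -> freevs R X)
    (mulY : freevs R Y -> freevs R Y -> freevs R Y)
    (starY : freevs R Y -> freevs R Y) (f : X -> Y) : Prop :=
  bijective f /\
  exists phi : freevs R X -> freevs R Y,
    [/\ linear phi,
        forall h, phi (bas R h) = bas R (f h),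
        forall u v, phi (mulX u v) = mulY (phi u) (phi v) &
        forall u, phi (starX u) = starY (phi u)].

(* [hdot] is linear in its first argument; see [inner] for the convention
   used everywhere else. *)
Record hilbert_space (R : realType) := HilbertSpace {
  hcarrier :> completeNormedModType R[i] ;
  hdot : {dot hcarrier for @Num.conj R[i]} ;
  hdot_norm : forall u, `|u| ^+ 2 = hdot u u }.

Section operators.
Context {R : realType}.
Implicit Types V H K : hilbert_space R.

(* The inner product <u, v>, linear in [v]. *)
Definition inner V (u v : V) : R[i] := hdot V v u.

Definition lin_span V (E : set V) : set V :=
  [set v | exists2 s : seq (R[i] * V), (forall p, p \in s -> E p.2) &
                                       v = \sum_(p <- s) p.1 *: p.2].

Definition orthonormal_basis V (E : set V) : Prop :=
  (forall u v, E u -> E v -> inner u v = (u == v)%:R) /\ dense (lin_span E).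

Definition separable V : Prop := exists2 S : set V, countable S & dense S.

Definition bounded_op V (A : V -> V) : Prop :=
  linear A /\ exists M : R[i], forall v, `|A v| <= M * `|v|.

Definition positive_op V (A : V -> V) : Prop :=
  bounded_op A /\ forall v, 0 <= inner v (A v).

(* The objects selected by [xget] below exist and are unique in every Hilbert
   space (for a bounded [A]), except for the basis [onb], which is an arbitrary
   choice on which traces do not depend. *)
Definition adjoint V (A : V -> V) : V -> V :=
  xget (fun=> 0) [set B | forall u v, inner (B u) v = inner u (A v)].

Definition abs_op V (A : V -> V) : V -> V :=
  xget (fun=> 0) [set B | positive_op B /\ B \o B = adjoint A \o A].

Definition onb V : set V := xget set0 [set E | orthonormal_basis E].
Arguments onb V : clear implicits.

Definition trace_norm V (A : V -> V) : \bar R :=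
  if `[< bounded_op A >]
  then \esum_(u in onb V) (complex.Re (inner u (abs_op A u)))%:E
  else +oo%E.

Definition trace_class V (A : V -> V) : Prop := (trace_norm A < +oo)%E.

Definition trace V (A : V -> V) : R[i] :=
  summability.sum (fun u : onb V => inner (val u) (A (val u)) : R[i]^o).

Definition is_state V (A : V -> V) : Prop :=
  [/\ trace_class A, positive_op A & trace A = 1].

(* Unconditional convergence of the sum of [f] to [A] in trace norm. *)
Definition trace_norm_sum V (I : choiceType) (f : I -> V -> V) (A : V -> V) :
    Prop :=
  trace_class A /\
  trace_norm (A - partial_sum f F) @[F --> totally] --> 0%E.

Definition ketbra V (u v : V) : V -> V := fun w => inner v w *: u.

(* These properties characterise the Hilbert space tensor product up to the
   unitary isomorphism that matches the pure tensors. *)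
Record hilbert_tensor H K := HilbertTensor {
  ht_space :> hilbert_space R ;
  pure : H -> K -> ht_space ;
  pure_linear_l : forall k, linear (pure^~ k) ;
  pure_linear_r : forall h, linear (pure h) ;
  pure_inner : forall h h' k k',
    inner (pure h k) (pure h' k') = inner h h' * inner k k' ;
  pure_dense : dense (lin_span [set t | exists h k, t = pure h k]) }.

Definition tensor_op H K (T : hilbert_tensor H K) (A : H -> H) (B : K -> K) :
    T -> T :=
  xget (fun=> 0)
    [set C | bounded_op C /\ forall h k, C (pure T h k) = pure T (A h) (B k)].

End operators.
Arguments onb {R} V.
Arguments tensor_op {R H K} T A B.

Record oqrw (R : realType) (D : distance_set) := OQRW {
  coin : hilbert_space R ;
  coin_separable : separable coin ;
  pos : hilbert_space R ;
  ket : D -> pos ;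
  ket_inj : injective ket ;
  ket_onb : orthonormal_basis (range ket) ;
  walk_space : hilbert_tensor coin pos ;
  walk_op : D -> D -> D -> coin -> coin ;
  walk_op_bounded : forall i j k, bounded_op (walk_op i j k) ;
  walk_op_sum : forall (j k : D) (h : coin),
    partial_sum
      (fun i : D => adjoint (walk_op i j k) (walk_op i j k h)) F
      @[F --> totally] --> h }.
Arguments ket {R D} o.
Arguments walk_op {R D} o.

Section walk.
Context {R : realType} {D : distance_set}.
Variable w : oqrw R D.

Local Notation T := (walk_space w).

Definition step_op (i j k : D) : T -> T :=
  tensor_op T (walk_op w i j k) (ketbra (ket w i) (ket w j)).

(* For every trace class [X] the sum converges in trace norm: this holds for
   positive [X], and these span the trace class operators.  Hence the limit is
   the linear extension of the map defined on positive operators. *)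
Definition walk_map (k : D) (X : T -> T) : T -> T :=
  xget (fun=> 0)
    [set Y | trace_norm_sum
      (fun p : D * D =>
         step_op p.1 p.2 k \o X \o adjoint (step_op p.1 p.2 k)) Y].

Definition block_diagonal (X : T -> T) (r : D -> coin w -> coin w) : Prop :=
  (forall i, trace_class (r i)) /\
  trace_norm_sum
    (fun i : D => tensor_op T (r i) (ketbra (ket w i) (ket w i))) X.

Definition blocks (X : T -> T) : D -> coin w -> coin w :=
  xget (fun _ _ => 0) [set r | block_diagonal X r].

Definition initial_state (rho0 : T -> T) : Prop :=
  is_state rho0 /\ exists r, block_diagonal rho0 r.

Variable rho0 : T -> T.

Definition walk_prob (k l m : D) : R[i] :=
  trace (blocks (walk_map k (walk_map l rho0)) m).

(* The bilinear extension of z_i o z_j = sum_k (walk_prob i j k) z_k, where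
   z_i is the basis vector [bas R i]; the last sum is finite under the first
   condition of [produces]. *)
Definition walk_mul (u v : freevs R D) : freevs R D :=
  \sum_(i \in [set: D]) \sum_(j \in [set: D])
    (coef i u * coef j v) *:
      \sum_(k \in [set: D]) walk_prob i j k *: bas R k.

Definition produces (star : freevs R D -> freevs R D) : Prop :=
  (forall k l : D, finite_set [set m | walk_prob k l m != 0]) /\
  is_hypergroup (@id D) walk_mul star.

End walk.

(* Main.v *)
(* The walk has the one-dimensional coin C, so that it is a classical Markov
   chain on the index set: with B_{i,j;k} = sqrt (q_{k,j}^i), where q are the
   structure constants, the condition on the sum of the B^* B is the
   normalisation of q.  Started from |0><0|, the map M_l leads to |l><l|, since
   x_l o x_0 = x_l, and M_k then leads to the sum of the q_{k,l}^m |m><m|, so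
   that the walk probabilities are the structure constants themselves.

   The space of the walk is l^2 over the index set (C (x) K is K itself).  The
   maps of the walk and the blocks of a state are defined as limits in trace
   norm, hence identifying them requires the limits to be unique.  This follows
   from |A v| <= ||A||_1 |v|, which rests on the existence of the adjoint and of
   the absolute value of a bounded operator, that is, on square roots of
   positive operators. *)

From HB Require Import structures.
Require Import Defs.
From mathcomp Require Import all_boot all_order all_algebra finmap complex.
From mathcomp Require Import all_classical all_reals all_analysis.
From mathcomp.analysis.showcase Require Import summability.
From mathcomp Require monalg.
Import (canonicals) monalg.
From mathcomp Require Import ring lra.

Set Implicit Arguments.
Unset Strict Implicit.
Unset Printing Implicit Defensive.
Import Order.TTheory GRing.Theory Num.Theory numFieldNormedType.Exports.
Local Open Scope classical_set_scope.
Local Open Scope ring_scope.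
Local Open Scope complex_scope.

(* Adjoints, absolute values, tensor operators, walk maps and blocks are all selected by [xget], so
   each calls for a witness and then for an argument that identifies the selected value. Witnesses
   for sums are cheap: a product of two basis elements has finite support, so every partial sum met
   here is eventually constant and its convergence reduces to the trace norm of 0. The work lies in
   the identification. Of [abs_op A] only two facts are used: it is positive, and
   [|abs_op A v| = |A v|]. They hold for whichever positive root is selected, and they suffice to
   estimate trace norms in the basis [onb V], which is itself an arbitrary choice. The general
   results take the existence of adjoints and of a basis as hypotheses; both are supplied by
   coordinates in [l^2]. Commutativity plays no part in the order of the indices: applying [M_l]
   first and [M_k] second multiplies by [x_k] on the left, which gives [q_{k,l}] exactly. The
   involution never meets the walk; it is carried over from the given hypergroup along the
   labelling. *)
#[local] Existing Instance totally_filter.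

(** * Inner product spaces *)

(** Stated for a semidefinite form on a plain module, because it serves three times: for [inner],
    for the form [<u, A v>] of a positive operator, and for [l2_dot] while [l^2] has no norm yet. *)
Lemma sesquilinear_CS (R : realType) (U : lmodType R[i])
    (f : U -> U -> R[i]) :
  (forall u, scalar (f u)) -> (forall u v, f v u = Num.conj (f u v)) ->
  (forall u, 0 <= f u u) ->
  forall u v, `|f u v| ^+ 2 <= f u u * f v v.
Proof.
move=> fl fC f0 u v.
have fD x y z : f x (y + z) = f x y + f x z.
  by have := fl x 1 y z; rewrite scale1r mul1r.
have fZ x c y : f x (c *: y) = c * f x y.
  have f00 : f x 0 = 0.
    by have := fD x 0 0; rewrite addr0 => /eqP; rewrite addrC -subr_eq subrr => /eqP.
  by have := fl x c y 0; rewrite !addr0 f00 addr0.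
have fDl x y z : f (y + z) x = f y x + f z x.
  by rewrite fC fD rmorphD /= -!fC.
have fZl x c y : f (c *: y) x = Num.conj c * f y x.
  by rewrite fC fZ rmorphM /= -!fC.
have fR x : Num.conj (f x x) = f x x by rewrite -fC.
pose a := f u u; pose b := f u v.
have exp s t : f (s *: u + t *: v) (s *: u + t *: v) =
    Num.conj s * s * a + Num.conj s * t * b +
    Num.conj t * s * Num.conj b + Num.conj t * t * f v v.
  rewrite fD !fDl !fZ !fZl /a /b (fC u v); ring.
have [a0|a0] := eqVneq a 0.
- have [b0|b0] := eqVneq b 0; first by rewrite -/b b0 normr0 expr0n /= mulr_ge0.
  have n0 : 0 < `|b| ^+ 2 by rewrite exprn_gt0 // normr_gt0.
  (* With [a = 0] the term quadratic in the multiple of [u] vanishes; this coefficient brings the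
     form down to -1, which is absurd. *)
  have := f0 ((- (f v v + 1) / (2 * Num.conj b)) *: u + 1 *: v).
  rewrite exp a0 /a !rmorphM !rmorph1.
  have c2 : Num.conj (2 : R[i]) = 2 by rewrite conjC_nat.
  have cb0 : Num.conj b != 0 by rewrite conjC_eq0.
  rewrite fmorphV !rmorphM rmorphN rmorphD rmorph1 /= fR conjCK c2.
  rewrite [X in 0 <= X](_ : _ = -1 :> R[i]) ?ler0N1 //.
  by field; rewrite b0 cb0.
- have ap : 0 < a by rewrite lt_def a0 f0.
  (* This is [a] times the part of [v] orthogonal to [u]. *)
  have := f0 (- b *: u + a *: v).
  rewrite exp rmorphN /= /a fR -/a.
  rewrite [X in 0 <= X](_ : _ = a * (a * f v v - b * Num.conj b)); last ring.
  by rewrite pmulr_rge0 // subr_ge0 -normCK.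
Qed.

Section inner_product.
Context {R : realType} {V : hilbert_space R}.
Local Notation C := R[i].
Implicit Types (u v w : V) (c : C).

Lemma innerC u v : inner v u = Num.conj (inner u v).
Proof.
rewrite /inner.
have /= := @sesquilinear.hermitian_subproof _ _ _ _ (hdot V) u v.
by rewrite expr0 mul1r.
Qed.

Lemma inner_scalar u : scalar (inner u).
Proof.
move=> c v w; rewrite /inner.
have := @sesquilinear.zmod_morphisml_subproof _ _ _ _ _ _ (hdot V) u.
have := @sesquilinear.linearl_subproof _ _ _ _ _ _ (hdot V) u.
move=> /= Z B.
have N : hdot V (- w) u = - hdot V w u by rewrite -scaleN1r Z mulN1r.
by rewrite -[w in LHS]opprK B Z N opprK.
Qed.

HB.instance Definition _ u := GRing.isLinear.Build _ _ _ _ (inner u)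
  (inner_scalar u).

Lemma innerDl u v w : inner (u + v) w = inner u w + inner v w.
Proof. by rewrite innerC linearD rmorphD /= -!innerC. Qed.

Lemma innerZl c v w : inner (c *: v) w = Num.conj c * inner v w.
Proof. by rewrite innerC linearZ rmorphM /= -innerC. Qed.

Lemma innerZr c v w : inner v (c *: w) = c * inner v w.
Proof. by rewrite linearZ. Qed.

Lemma innerNl v w : inner (- v) w = - inner v w.
Proof. by rewrite innerC linearN rmorphN /= -innerC. Qed.

Lemma innerBl u v w : inner (u - v) w = inner u w - inner v w.
Proof. by rewrite innerDl innerNl. Qed.

Lemma inner0l v : inner 0 v = 0.
Proof. by rewrite innerC linear0 rmorph0. Qed.

Lemma inner_suml (I : Type) (r : seq I) (P : pred I) (F : I -> V) v :
  inner (\sum_(i <- r | P i) F i) v = \sum_(i <- r | P i) inner (F i) v.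
Proof.
by rewrite innerC linear_sum rmorph_sum /=; apply: eq_bigr => i _; rewrite -innerC.
Qed.

Lemma inner_norm u : inner u u = `|u| ^+ 2.
Proof. by rewrite /inner hdot_norm. Qed.

Lemma inner_ge0 u : 0 <= inner u u.
Proof. by rewrite inner_norm exprn_ge0. Qed.

Lemma inner_eq0 u : (inner u u == 0) = (u == 0).
Proof. by rewrite inner_norm expf_eq0 normr_eq0. Qed.

Lemma inner_CS u v : `|inner u v| <= `|u| * `|v|.
Proof.
rewrite -(@ler_pXn2r _ 2) ?nnegrE ?mulr_ge0 // exprMn -!inner_norm.
exact: sesquilinear_CS inner_scalar innerC inner_ge0 _ _.
Qed.

Lemma inner_ext u v : (forall w, inner w u = inner w v) -> u = v.
Proof.
move=> uv; apply/eqP; rewrite -subr_eq0 -inner_eq0 linearB /= uv subrr //.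
Qed.

Lemma inner_continuous u : continuous (inner u : V -> C^o).
Proof.
move=> v; apply/cvgrPdist_lt => e e0.
have d0 : 0 < e / (`|u| + 1) by rewrite divr_gt0 // ltr_wpDl.
have /cvgrPdist_lt /(_ _ d0) := @cvg_id _ (nbhs v).
apply: filterS => w; rewrite ltr_pdivlMr ?ltr_wpDl // => uvw.
rewrite -linearB /= (le_lt_trans (inner_CS _ _)) // mulrC (le_lt_trans _ uvw) //.
by rewrite ler_wpM2l // lerDl.
Qed.

End inner_product.

(** * Finite projections: Pythagoras, Bessel and Parseval *)

Section orthonormal_families.
Context {R : realType} {V : hilbert_space R} {I : choiceType}.
Local Notation C := R[i].
Implicit Types (u v w : V) (e : I -> V) (A B : {fset I}).

Definition oproj e A v : V := \sum_(i <- A) inner (e i) v *: e i.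

Definition orthonormal_on e A : Prop :=
  {in A &, forall i j, inner (e i) (e j) = (i == j)%:R}.

Lemma inner_proj e A i v : orthonormal_on e A -> i \in A ->
  inner (e i) (oproj e A v) = inner (e i) v.
Proof.
move=> eA iA; rewrite /oproj linear_sum (big_fsetD1 i) //= innerZr eA // eqxx mulr1.
rewrite big_seq big1 ?addr0 // => j; rewrite in_fsetD1 => /andP[ji jA].
by rewrite innerZr eA // eq_sym (negPf ji) mulr0.
Qed.

Lemma inner_proj_diff e A v : orthonormal_on e A ->
  inner (oproj e A v) (v - oproj e A v) = 0.
Proof.
move=> eA; rewrite {1}/oproj inner_suml big_seq big1 // => i iA.
by rewrite innerZl linearB /= inner_proj // subrr mulr0.
Qed.

Lemma norm_proj e A v : orthonormal_on e A ->
  `|oproj e A v| ^+ 2 = \sum_(i <- A) `|inner (e i) v| ^+ 2.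
Proof.
move=> eA; rewrite -inner_norm {1}/oproj inner_suml big_seq [RHS]big_seq.
apply: eq_bigr => i iA; rewrite innerZl inner_proj // normCK mulrC //.
Qed.

Lemma pythagoras e A v : orthonormal_on e A ->
  `|v| ^+ 2 = `|oproj e A v| ^+ 2 + `|v - oproj e A v| ^+ 2.
Proof.
move=> eA; rewrite -!inner_norm.
have pd := inner_proj_diff v eA.
move: (oproj e A v) pd => p; rewrite -{2 3}[v](subrK p); move: (v - p) => d pd.
have dp : inner d p = 0 by rewrite innerC pd rmorph0.
by rewrite linearD /= !innerDl pd dp addr0 add0r addrC.
Qed.

Lemma bessel e A v : orthonormal_on e A ->
  \sum_(i <- A) `|inner (e i) v| ^+ 2 <= `|v| ^+ 2.
Proof. by move=> eA; rewrite (pythagoras v eA) -norm_proj // lerDl exprn_ge0. Qed.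

Lemma dist_proj_le e A v : orthonormal_on e A -> `|v - oproj e A v| <= `|v|.
Proof.
move=> eA; rewrite -(@ler_pXn2r _ 2) ?nnegrE //.
by rewrite (pythagoras v eA) lerDr exprn_ge0.
Qed.

Lemma proj_is_linear e A : linear (oproj e A).
Proof.
move=> c u v; rewrite /oproj scaler_sumr -big_split /=.
by apply: eq_bigr => i _; rewrite inner_scalar scalerDl scalerA.
Qed.

Lemma proj_basis e A i : orthonormal_on e A -> i \in A -> oproj e A (e i) = e i.
Proof.
move=> eA iA; rewrite /oproj (big_fsetD1 i) //= eA // eqxx scale1r.
rewrite big_seq big1 ?addr0 // => j; rewrite in_fsetD1 => /andP[ji jA].
by rewrite eA // (negPf ji) scale0r.
Qed.

(** A vector of the span involves finitely many basis vectors, and every projection whose index set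
    contains them fixes it; this is the form that convergence along [totally] asks for. *)
Lemma proj_lin_span e w : (forall A, orthonormal_on e A) ->
  lin_span (range e) w -> exists A, forall B, (A `<=` B)%fset -> oproj e B w = w.
Proof.
move=> eo [s sE ->]; elim: s sE => [|p s IH] sE.
  exists fset0 => B _; rewrite big_nil /oproj big1 // => i _.
  by rewrite linear0 scale0r.
have [|A IHA] := IH; first by move=> q qs; apply: sE; rewrite inE qs orbT.
have [i _ ip] : range e p.2 by apply: sE; rewrite mem_head.
exists (i |` A)%fset => B; rewrite fsubUset fsub1set => /andP[iB AB].
by rewrite big_cons proj_is_linear IHA // -ip proj_basis.
Qed.

Section basis.
Variable e : I -> V.
Hypothesis eo : forall i j, inner (e i) (e j) = (i == j)%:R.
Hypothesis ed : dense (lin_span (range e)).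

Lemma orthonormal_onW A : orthonormal_on e A.
Proof. by move=> i j _ _; exact: eo. Qed.

Lemma dist_proj_lt v (d : C) : 0 < d ->
  exists A, forall B, (A `<=` B)%fset -> `|v - oproj e B v| < d.
Proof.
move=> d0.
have [w [vw /(proj_lin_span orthonormal_onW)[A HA]]] :
    ball v d `&` lin_span (range e) !=set0.
  by apply: ed; [exists v; exact: ballxx|exact: ball_open].
exists A => B /HA Bw.
(* [1 - P] kills the approximant [w] and is a contraction. *)
have -> : v - oproj e B v = (v - w) - oproj e B (v - w).
  have /(_ (-1) w v) := proj_is_linear e B; rewrite !scaleN1r => P.
  by rewrite [v - w]addrC P Bw opprD opprK addrACA addNr add0r.
apply: le_lt_trans (dist_proj_le (v - w) (@orthonormal_onW B)) _.
by move: vw; rewrite -ball_normE.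
Qed.

Lemma proj_cvg v : oproj e ^~ v @ totally --> v.
Proof.
apply/cvgrPdist_lt => d /(dist_proj_lt v)[A HA].
by exists A => // B /= /HA.
Qed.

(** If [K < |v|^2], a projection that misses less than [|v|^2 - K] of the squared norm has, by
    Pythagoras, a coefficient sum above [K]. *)
Lemma parseval_le v (K : C) :
  (forall A, \sum_(i <- A) `|inner (e i) v| ^+ 2 <= K) -> `|v| ^+ 2 <= K.
Proof.
move=> HK; have K0 : 0 <= K by rewrite (le_trans _ (HK fset0)) // big_seq_fset0.
have Kr : K \is Num.real by rewrite ger0_real.
rewrite real_leNgt ?ger0_real ?exprn_ge0 //; apply/negP => Kv.
have d0 : 0 < `|v| ^+ 2 - K by rewrite subr_gt0.
have d1 : 0 < sqrtC (`|v| ^+ 2 - K) by rewrite sqrtC_gt0.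
have [A /(_ A (fsubset_refl _)) HA] := dist_proj_lt v d1.
have := HK A; rewrite -norm_proj; last exact: orthonormal_onW.
have HA2 : `|v - oproj e A v| ^+ 2 < `|v| ^+ 2 - K.
  by rewrite -[ltRHS]sqrtCK ltr_pXn2r ?nnegrE ?(ltW d1).
have := pythagoras v (@orthonormal_onW A) => E HB.
by have := ler_ltD HB HA2; rewrite -E addrC subrK ltxx.
Qed.

End basis.
End orthonormal_families.

(** * Bounded operators *)

Section linear_maps.
Context {R : pzRingType} {U V : lmodType R} {A : U -> V}.
Hypothesis Al : linear A.

Lemma linearP_D u v : A (u + v) = A u + A v.
Proof. by have := Al 1 u v; rewrite !scale1r. Qed.

Lemma linearP_0 : A 0 = 0.
Proof. by apply: (@addrI _ (A 0)); rewrite -linearP_D !addr0. Qed.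

Lemma linearP_Z c v : A (c *: v) = c *: A v.
Proof. by have := Al c v 0; rewrite linearP_0 !addr0. Qed.

Lemma linearP_N v : A (- v) = - A v.
Proof. by rewrite -scaleN1r linearP_Z scaleN1r. Qed.

Lemma linearP_B u v : A (u - v) = A u - A v.
Proof. by rewrite linearP_D linearP_N. Qed.

Lemma linearP_sum (I : Type) (r : seq I) (F : I -> U) :
  A (\sum_(i <- r) F i) = \sum_(i <- r) A (F i).
Proof.
elim: r => [|i r IH]; first by rewrite !big_nil linearP_0.
by rewrite !big_cons linearP_D IH.
Qed.

End linear_maps.

Lemma cvg_norm_le (R : realType) (V : normedModType R[i]) (T : Type)
    (F : set_system T) (f : T -> V) (a : V) (K : R[i]) : ProperFilter F ->
  (\forall x \near F, `|f x| <= K) -> f @ F --> a -> `|a| <= K.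
Proof.
move=> PF fK fa.
have K0 : 0 <= K by have [x /=] := filter_ex fK; apply: le_trans.
rewrite real_leNgt ?ger0_real //; apply/negP => Ka.
have d0 : 0 < `|a| - K by rewrite subr_gt0.
move/cvgrPdist_lt : fa => /(_ _ d0) near_a.
have [x [/= fx ax]] := filter_ex (filterI fK near_a).
have := le_lt_trans (ler_normD (a - f x) (f x)) (ltr_leD ax fx).
by rewrite !subrK ltxx.
Qed.

Section bounded_operators.
Context {R : realType} {V : hilbert_space R}.
Local Notation C := R[i].
Implicit Types (u v w : V) (c : C) (A B : V -> V).

Definition symmetric_op A : Prop := forall u v, inner (A u) v = inner u (A v).

(** The bound in [bounded_op] is a complex number. A nonzero vector forces it to be real and
    nonnegative, but on the zero space it is arbitrary, hence the modulus of its real part; the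
    added 1 allows division by it. *)
Lemma bounded_op_pos A : bounded_op A ->
  exists2 M : R, 0 < M & forall v, `|A v| <= M%:C * `|v|.
Proof.
move=> [_ [M HM]]; exists (`|complex.Re M| + 1); first by rewrite ltr_wpDl.
move=> v; have [->|v0] := eqVneq v 0.
  by have := HM 0; rewrite normr0 !mulr0.
rewrite (le_trans (HM v)) // ler_wpM2r //.
have M0 : 0 <= M.
  by have := le_trans (normr_ge0 _) (HM v); rewrite pmulr_lge0 // normr_gt0.
rewrite -[leLHS]RRe_real ?ger0_real // lecR.
by rewrite (le_trans (ler_norm _)) // lerDl.
Qed.

Lemma bounded_op_id : bounded_op (@id V).
Proof. by split=> //; exists 1 => v; rewrite mul1r. Qed.

Lemma bounded_op0 : bounded_op (fun _ : V => 0 : V).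
Proof.
split=> [c u v|]; first by rewrite scaler0 addr0.
by exists 0 => v; rewrite normr0 mul0r.
Qed.

Lemma bounded_opD A B : bounded_op A -> bounded_op B -> bounded_op (A + B).
Proof.
move=> [Al [M HM]] [Bl [N HN]]; split.
  by move=> c u v; rewrite !fctE Al Bl scalerDr addrACA.
exists (M + N) => v; rewrite fctE mulrDl (le_trans (ler_normD _ _)) //.
exact: lerD.
Qed.

Lemma bounded_opZ c A : bounded_op A -> bounded_op (fun v => c *: A v).
Proof.
move=> [Al [M HM]]; split.
  by move=> d u v; rewrite Al scalerDr !scalerA mulrC.
by exists (`|c| * M) => v; rewrite normrZ -mulrA ler_wpM2l.
Qed.

Lemma bounded_opB A B : bounded_op A -> bounded_op B -> bounded_op (A - B).
Proof.
move=> bA bB; rewrite [X in bounded_op X](_ : _ = A + (fun v => -1 *: B v)).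
  by apply: bounded_opD => //; exact: bounded_opZ.
by apply/funext => v; rewrite !fctE scaleN1r.
Qed.

Lemma bounded_op_ketbra u v : bounded_op (ketbra u v).
Proof.
split=> [c w w'|]; first by rewrite /ketbra inner_scalar scalerDl scalerA.
exists (`|u| * `|v|) => w; rewrite /ketbra normrZ mulrC -mulrA ler_wpM2l //.
exact: inner_CS.
Qed.

Lemma symmetric_op_real A v : symmetric_op A -> inner v (A v) \is Num.real.
Proof. by move=> As; rewrite CrealE -innerC As. Qed.

(** By [inner_ext] there is at most one adjoint, so an exhibited one is the one that [xget]
    selects. *)
Lemma adjointE A B :
  (forall u v, inner (B u) v = inner u (A v)) -> adjoint A = B.
Proof.
move=> BA; rewrite /adjoint.
have : [set B | forall u v, inner (B u) v = inner u (A v)] B by [].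
move=> /(xgetI (fun=> 0)) /= AA; apply/funext => u.
by apply: inner_ext => w; rewrite innerC AA -BA -innerC.
Qed.

Lemma adjoint_scale c : adjoint (fun v : V => c *: v) = *:%R (Num.conj c).
Proof. by apply: adjointE => u v; rewrite innerZl conjCK innerZr. Qed.

Lemma adjoint_ketbra c u v :
  adjoint (fun w => c *: ketbra u v w) = (fun w => Num.conj c *: ketbra v u w).
Proof.
apply: adjointE => w w'; rewrite /ketbra !innerZl !innerZr conjCK -innerC.
by rewrite [_ * inner w u]mulrC.
Qed.

(** Polarisation: that [<w, A w>] is real gives [E3] at [w = u + v] and [E4] at [w = u + i v]; their
    sum is the claim up to a factor 2. *)
Lemma positive_op_sym A : positive_op A -> symmetric_op A.
Proof.
move=> [[Al _] A0] u v; rewrite innerC; apply/esym.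
have ge0_conj w : Num.conj (inner w (A w)) = inner w (A w).
  by apply/CrealP; rewrite ger0_real.
(* Only these two properties of ['i] enter the computation, so it becomes a variable for [ring]. *)
have [j j0 cj] : exists2 j : C, j != 0 & Num.conj j = - j.
  by exists 'i; [exact: neq0Ci|exact: conjCi].
have := ge0_conj (u + v); have := ge0_conj (u + j *: v).
rewrite !(linearP_D Al) (linearP_Z Al) !linearD !linearZ /= !innerDl !innerZl.
rewrite !rmorphD /= !rmorphM /= !rmorphD /= !rmorphM /= !ge0_conj.
rewrite !cj !rmorphN /= !cj !opprK.
move: (inner u (A u)) (inner v (A v)) (inner u (A v)) (inner v (A u)).
move=> a d b c E1 E2.
have E3 : Num.conj b + Num.conj c = b + c.
  apply: (@addrI _ (a + d)); transitivity (a + c + (b + d)); last ring.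
  by rewrite -E2; ring.
have E4 : Num.conj c - Num.conj b = b - c.
  apply: (mulfI j0); apply: (@addrI _ (a - j * j * d)).
  transitivity (a + - j * c + j * (b + - j * d)); last ring.
  by rewrite -E1; ring.
have two0 : (2 : C) != 0 by rewrite pnatr_eq0.
apply: (mulfI two0).
by rewrite (_ : 2 * b = (b + c) + (b - c)); [rewrite -E3 -E4; ring|ring].
Qed.

Lemma positive_op_CS A u v : positive_op A ->
  `|inner u (A v)| ^+ 2 <= inner u (A u) * inner v (A v).
Proof.
move=> Ap; have As := positive_op_sym Ap.
apply: (sesquilinear_CS (f := fun u v => inner u (A v))).
- by move=> w c x y; rewrite Ap.1.1 inner_scalar.
- by move=> x y; rewrite -innerC As.
- exact: Ap.2.
Qed.

End bounded_operators.

(** * Square roots and the trace norm *)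

Section square_root.
Context {R : realType} {V : hilbert_space R}.
Local Notation C := R[i].
Implicit Types (u v w : V).
Variable T : V -> V.
Hypothesis Tl : linear T.
Hypothesis Ts : symmetric_op T.
Hypothesis T1 : forall v, `|T v| <= `|v|.

(* The increasing iterates of [y |-> (T + y ^ 2) / 2] tend to
   [1 - sqrt (1 - T)]; since they are polynomials in [T] with nonnegative
   coefficients, the scalar iteration with [T = 1] controls their increments. *)
Fixpoint sqrt_iter (n : nat) (v : V) : V :=
  if n is m.+1 then 2^-1 *: (T v + sqrt_iter m (sqrt_iter m v)) else 0.

Fixpoint sqrt_bound (n : nat) : R :=
  if n is m.+1 then (1 + sqrt_bound m ^+ 2) / 2 else 0.

Local Notation Y := sqrt_iter.
Local Notation y := sqrt_bound.

Lemma sqrt_boundS n : y n.+1 = (1 + y n ^+ 2) / 2. Proof. by []. Qed.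

Lemma sqrt_bound_ge0 n : 0 <= y n.
Proof. by elim: n => [|n IH] //=; rewrite divr_ge0 // addr_ge0 // exprn_ge0. Qed.

Lemma sqrt_bound_le1 n : y n <= 1.
Proof.
elim: n => [|n IH] //=; rewrite ler_pdivrMr // mul1r.
by have := sqrt_bound_ge0 n => y0; nra.
Qed.

Lemma sqrt_bound_nd : nondecreasing_seq y.
Proof.
apply/nondecreasing_seqP; elim=> [|n IH]; first exact: sqrt_bound_ge0.
rewrite /= ler_pM2r ?invr_gt0 // lerD2l ler_pXn2r // nnegrE;
  [exact: sqrt_bound_ge0|exact: (sqrt_bound_ge0 n.+1)].
Qed.

Lemma sqrt_iter_linear n : linear (Y n).
Proof.
elim: n => [|n IH] c u v /=; first by rewrite scaler0 addr0.
rewrite Tl !IH [in RHS]scalerA [c * _]mulrC -scalerA -scalerDr.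
by congr (_ *: _); rewrite scalerDr addrACA.
Qed.

Lemma sqrt_iter_sym n : symmetric_op (Y n).
Proof.
elim: n => [|n IH] u v /=; first by rewrite inner0l linear0.
by rewrite innerZl innerZr innerDl linearD /= Ts !IH fmorphV rmorph_nat.
Qed.

Lemma sqrt_iter_le n v : `|Y n v| <= (y n)%:C * `|v|.
Proof.
elim: n v => [|n IH] v /=; first by rewrite normr0 mul0r.
have -> : ((1 + y n ^+ 2) / 2)%:C * `|v| =
    2^-1 * (`|v| + (y n)%:C * ((y n)%:C * `|v|)).
  by rewrite rmorphM fmorphV rmorph_nat rmorphD rmorph1 rmorphXn /=; ring.
rewrite normrZ ger0_norm ?invr_ge0 // ler_wpM2l ?invr_ge0 //.
rewrite (le_trans (ler_normD _ _)) // lerD // (le_trans (IH _)) //.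
by rewrite ler_wpM2l ?ler0c ?sqrt_bound_ge0.
Qed.

(** Writing [D] for [Y_(n+1) - Y_n], the difference of squares is [Y_(n+1) D + D Y_n]; each term is
    bounded by its scalar counterpart, and the scalar increment splits in the same way. *)
Lemma sqrt_iterS_dist n v : `|Y n.+1 v - Y n v| <= (y n.+1 - y n)%:C * `|v|.
Proof.
elim: n v => [|n IH] v.
  by have := sqrt_iter_le 1 v; rewrite /= !subr0.
rewrite [Y n.+2]/= [Y n.+1 in X in _ - X]/= -scalerBr opprD addrACA subrr add0r.
have -> : Y n.+1 (Y n.+1 v) - Y n (Y n v) =
    Y n.+1 (Y n.+1 v - Y n v) + (Y n.+1 (Y n v) - Y n (Y n v)).
  by rewrite (linearP_B (sqrt_iter_linear _)) addrA subrK.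
have -> : (y n.+2 - y n.+1)%:C * `|v| =
    2^-1 * ((y n.+1)%:C * ((y n.+1 - y n)%:C * `|v|) +
            (y n.+1 - y n)%:C * ((y n)%:C * `|v|)).
  have -> : y n.+2 - y n.+1 = 2^-1 * (y n.+1 * (y n.+1 - y n) + (y n.+1 - y n) * y n).
    by rewrite (sqrt_boundS n.+1) [X in _ - X = _]sqrt_boundS; field.
  by rewrite rmorphM fmorphV rmorph_nat rmorphD !rmorphM /=; ring.
have d0 : 0 <= (y n.+1 - y n)%:C :> C by rewrite ler0c subr_ge0; exact: sqrt_bound_nd.
rewrite normrZ ger0_norm ?invr_ge0 // ler_wpM2l ?invr_ge0 //.
rewrite (le_trans (ler_normD _ _)) // lerD //.
  rewrite (le_trans (sqrt_iter_le _ _)) // ler_wpM2l // ler0c.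
  exact: (sqrt_bound_ge0 n.+1).
by rewrite (le_trans (IH _)) // ler_wpM2l // sqrt_iter_le.
Qed.

Lemma sqrt_iter_dist m n v : (m <= n)%N ->
  `|Y n v - Y m v| <= (y n - y m)%:C * `|v|.
Proof.
move=> /subnKC <-; elim: (n - m)%N => [|k IH].
  by rewrite addn0 !subrr normr0 mul0r.
rewrite addnS -(subrKA (Y (m + k) v)) (le_trans (ler_normD _ _)) //.
rewrite -(subrKA (y (m + k))) rmorphD mulrDl lerD //; exact: sqrt_iterS_dist.
Qed.

(** The scalars [sqrt_bound n] increase and stay below 1, hence converge; their increments dominate
    those of the iterates, which are therefore Cauchy. *)
Lemma sqrt_iter_cvg v : cvg (Y n v @[n --> \oo]).
Proof.
apply: cauchy_cvg; apply: cauchy_exP => e e0.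
have [r er] : exists r : R, e = r%:C.
  by exists (complex.Re e); rewrite RRe_real // gtr0_real.
have r0 : 0 < r by rewrite -ltcR -er.
have [s vs] : exists s : R, `|v| = s%:C.
  by exists (complex.Re `|v|); rewrite RRe_real.
have s0 : 0 <= s by rewrite -ler0c -vs.
have /cvg_ex[l yl] : cvgn y.
  apply: nondecreasing_is_cvgn; first exact: sqrt_bound_nd.
  by exists 1 => _ [n _ <-]; exact: sqrt_bound_le1.
have yle n : y n <= l.
  by rewrite -(cvg_lim _ yl) //; apply: nondecreasing_cvgn_le;
    [exact: sqrt_bound_nd|apply/cvg_ex; exists l].
have d0 : 0 < r / (s + 1) by rewrite divr_gt0 // ltr_wpDl.
have /cvgrPdist_lt /(_ _ d0) [N _ /(_ N (leqnn N)) /=] := yl.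
rewrite ger0_norm ?subr_ge0 // ltr_pdivlMr ?ltr_wpDl // => ylN.
exists (Y N v); exists N => // n /= Nn; rewrite -ball_normE /= distrC.
rewrite (le_lt_trans (sqrt_iter_dist v Nn)) // er vs -rmorphM ltcR.
rewrite (le_lt_trans _ ylN) //.
by rewrite ler_pM ?subr_ge0 ?lerB ?lerDl //; exact: sqrt_bound_nd.
Qed.

Definition sqrt_lim v : V := lim (Y n v @[n --> \oo]).
Local Notation L := sqrt_lim.

Lemma sqrt_lim_cvg v : Y n v @[n --> \oo] --> L v.
Proof. exact: sqrt_iter_cvg. Qed.

Lemma sqrt_lim_linear : linear L.
Proof.
move=> c u v; apply: cvg_lim => //.
rewrite (_ : (fun n => _) = (fun n => c *: Y n u + Y n v)); last first.
  by apply/funext => n; exact: sqrt_iter_linear.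
by apply: cvgD; [apply: cvgZr|]; exact: sqrt_lim_cvg.
Qed.

Lemma sqrt_lim_le v : `|L v| <= `|v|.
Proof.
apply: (cvg_norm_le _ _ (sqrt_lim_cvg (v := v))); apply: nearW => n.
rewrite (le_trans (sqrt_iter_le _ _)) // -[leRHS]mul1r ler_wpM2r //.
by rewrite lecR sqrt_bound_le1.
Qed.

Lemma sqrt_lim_sym : symmetric_op L.
Proof.
move=> u v; rewrite innerC.
have cv w w' : inner w (Y n w') @[n --> \oo] --> (inner w (L w') : C^o).
  apply: (@cvg_comp _ _ _ (fun n => Y n w') (inner w : V -> C^o));
    [exact: sqrt_lim_cvg|exact: inner_continuous].
have E : inner u (L v) - Num.conj (inner v (L u)) = 0; last first.
  by apply/esym/eqP; rewrite -subr_eq0 E.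
apply/eqP; rewrite -normr_le0.
apply: (cvg_norm_le (V := C^o) _ _
  (_ : (fun n => inner u (Y n v) - Num.conj (inner v (Y n u))) @ \oo --> _)).
  by apply: nearW => n; rewrite -innerC sqrt_iter_sym subrr normr0.
apply: (@cvgB _ C^o _ _ _ (fun n => inner u (Y n v))
  (fun n => Num.conj (inner v (Y n u)))); first exact: cv.
apply/cvgrPdist_lt => e e0; have /(@cvgrPdist_lt _ C^o) /(_ _ e0) := cv v u.
by apply: filterS => n; rewrite -rmorphB norm_conjC.
Qed.

Lemma sqrt_lim_fix v : L v = 2^-1 *: (T v + L (L v)).
Proof.
rewrite {1}/sqrt_lim; apply: cvg_lim => //.
rewrite -(cvg_shiftS (fun n => Y n v)) /=.
apply: cvgZr; apply: cvgD; first exact: cvg_cst.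
(* Operator and argument both vary with [n]. All iterates are contractions, so the first term tends
   to 0, and the second tends to [L (L v)]. *)
rewrite (_ : (fun n => _) = (fun n => Y n (Y n v - L v) + Y n (L v))); last first.
  by apply/funext => n; rewrite (linearP_B (sqrt_iter_linear n)) subrK.
rewrite -[X in _ --> X]add0r; apply: cvgD; last exact: sqrt_lim_cvg.
apply/cvgrPdist_lt => e e0; have /cvgrPdist_lt /(_ _ e0) := sqrt_lim_cvg (v := v).
apply: filterS => n; rewrite sub0r normrN distrC; apply: le_lt_trans.
rewrite (le_trans (sqrt_iter_le _ _)) // -[leRHS]mul1r ler_wpM2r //.
by rewrite lecR sqrt_bound_le1.
Qed.

(** The fixed-point equation [2 L = T + L^2] reads [(1 - L)^2 = 1 - T]. The root [1 - L] is positive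
    because [L] is a symmetric contraction, whence [<v, L v> <= |v|^2]. *)
Lemma contraction_sqrt : exists2 B : V -> V, positive_op B &
  forall v, B (B v) = v - T v.
Proof.
exists (fun v => v - L v); last first.
  move=> v; rewrite (linearP_B sqrt_lim_linear).
  have := sqrt_lim_fix v => /(congr1 (fun w => 2 *: w)).
  rewrite scalerA divff ?pnatr_eq0 // scale1r => E.
  have -> : T v = 2 *: L v - L (L v) by rewrite E addrK.
  by rewrite scaler_nat mulr2n !opprB opprD -!addrA [- L v + (_ + _)]addrCA.
split.
  have bL : bounded_op L.
    by split; [exact: sqrt_lim_linear|exists 1 => v; rewrite mul1r sqrt_lim_le].
  exact: bounded_opB bounded_op_id bL.
move=> v; rewrite linearB /= subr_ge0 inner_norm expr2.
rewrite (le_trans (real_ler_norm _)) //; first exact: symmetric_op_real sqrt_lim_sym.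
by rewrite (le_trans (inner_CS _ _)) // ler_wpM2l // sqrt_lim_le.
Qed.

End square_root.

(** * Absolute values of bounded operators *)

Section absolute_value.
Context {R : realType} {V : hilbert_space R}.
Local Notation C := R[i].
Implicit Types (u v w : V) (A B W : V -> V).

(** With [M] a bound of [W], take the root of [W' W / M^2 = 1 - T] and multiply it by [M]. *)
Lemma abs_op_exists W W' : bounded_op W ->
  (forall u v, inner (W' u) v = inner u (W v)) ->
  exists B, positive_op B /\ B \o B = W' \o W.
Proof.
move=> Wb WW'; have [M M0 HM] := bounded_op_pos Wb; have Wl := Wb.1.
have W'W u v : inner v (W' u) = inner (W v) u by rewrite innerC WW' -innerC.
have M0C : 0 < M%:C :> C by rewrite ltcR.
have W'l : linear W'.
  move=> c u v; apply: inner_ext => w.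
  by rewrite linearD linearZ /= !W'W linearD linearZ.
(* [|W' u|^2 = <u, W (W' u)> <= |u| M |W' u|], so the bound of [W] also serves [W']. *)
have W'le u : `|W' u| <= M%:C * `|u|.
  have [->|u0] := eqVneq (W' u) 0.
    by rewrite normr0 mulr_ge0 ?ler0c // ltW.
  rewrite -(@ler_pM2l _ `|W' u|) ?normr_gt0 // -expr2 -inner_norm WW'.
  rewrite (le_trans (real_ler_norm _)) //.
    by rewrite -WW' inner_norm ger0_real ?exprn_ge0.
  rewrite (le_trans (inner_CS _ _)) // mulrC mulrA ler_wpM2r //.
  by rewrite mulrC HM.
pose T v := v - M%:C ^- 2 *: W' (W v).
have Mr : Num.conj (M%:C ^- 2) = M%:C ^- 2 :> C.
  by apply/CrealP; rewrite rpredV rpredX // ger0_real // ltW.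
have P0 : 0 <= M%:C ^- 2 :> C by rewrite invr_ge0 exprn_ge0 // ltW.
have Tl : linear T.
  move=> c u v; rewrite /T Wl W'l scalerBr !scalerDr !scalerA opprD addrACA.
  by rewrite [M%:C ^- 2 * c]mulrC.
have Ts : symmetric_op T.
  move=> u v; rewrite /T innerBl linearB /= innerZl innerZr Mr.
  by rewrite WW' W'W.
(* Expanding, [|v|^2 - |T v|^2 = M^-2 (2 |W v|^2 - M^-2 |W' W v|^2)], and [|W' W v| <= M |W v|]. *)
have T1 v : `|T v| <= `|v|.
  rewrite -(@ler_pXn2r _ 2) ?nnegrE // -!inner_norm /T.
  rewrite innerBl !linearB /= !innerZl !innerZr Mr W'W WW'.
  rewrite [inner (W v) (W v)]inner_norm [inner (W' _) _]inner_norm.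
  rewrite -subr_ge0 (_ : _ - _ = M%:C ^- 2 * (2 * `|W v| ^+ 2 - M%:C ^- 2 *
    `|W' (W v)| ^+ 2)); last by ring.
  rewrite mulr_ge0 // mulr2n mulrDl mul1r subr_ge0.
  rewrite (@le_trans _ _ (`|W v| ^+ 2)) ?lerDl ?exprn_ge0 //.
  rewrite mulrC ler_pdivrMr ?exprn_gt0 // mulrC -exprMn.
  by rewrite ler_pXn2r ?nnegrE ?mulr_ge0 // ltW.
have [B Bp BB] := contraction_sqrt Tl Ts T1.
exists (fun v => M%:C *: B v); split; first split.
- exact: bounded_opZ Bp.1.
- by move=> v; rewrite innerZr mulr_ge0 ?(ltW M0C) // Bp.2.
- apply/funext => v /=; rewrite (linearP_Z Bp.1.1) BB /T opprB addrC subrK !scalerA.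
  by rewrite -expr2 divff ?scale1r // expf_neq0 // gt_eqF.
Qed.

(** Whichever positive root [xget] picks, its symmetry gives [|B v|^2 = <v, B^2 v> = |W v|^2]. *)
Lemma abs_opP W W' : bounded_op W ->
  (forall u v, inner (W' u) v = inner u (W v)) ->
  positive_op (abs_op W) /\ forall v, `|abs_op W v| = `|W v|.
Proof.
move=> Wb WW'; rewrite /abs_op (adjointE WW').
have [B0 B0P] := abs_op_exists Wb WW'.
have : [set B | positive_op B /\ B \o B = W' \o W] B0 by [].
move=> /(xgetI (fun=> 0)); set B := xget _ _ => -[Bp BB]; split=> // v.
apply/eqP; rewrite -(@eqrXn2 _ 2) // -!inner_norm (positive_op_sym Bp).
by rewrite -[B (B v)]/((B \o B) v) BB /= innerC WW' -innerC.
Qed.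

End absolute_value.

(** * The trace norm dominates the operator norm *)

Section trace_norm.
Context {R : realType} {V : hilbert_space R}.
Local Notation C := R[i].
Implicit Types (u v w : V) (A B W : V -> V).
Hypothesis V_onb : exists E : set V, orthonormal_basis E.

Lemma onbP : orthonormal_basis (onb V).
Proof. by have [E HE] := V_onb; exact: (xgetI set0 HE). Qed.

Lemma onb_val (i j : onb V) : inner (val i) (val j) = (i == j)%:R.
Proof. by rewrite onbP.1 //; exact: set_valP. Qed.

Lemma onb_dense : dense (lin_span (range (val : onb V -> V))).
Proof.
have -> : range (val : onb V -> V) = onb V; last exact: onbP.2.
apply/seteqP; split=> [_ [i _ <-]|v Ev]; first exact: set_valP.
by exists (SigSub (mem_set Ev)).
Qed.

(** Summing over the type [onb V] instead of the set turns the basis into an indexed family, as the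
    projection lemmas expect. *)
Lemma trace_normE A : bounded_op A ->
  trace_norm A =
  \esum_(i in [set: onb V]) (complex.Re (inner (val i) (abs_op A (val i))))%:E.
Proof.
move=> Ab; rewrite /trace_norm asboolT //.
rewrite (reindex_esum [set: onb V] (onb V) (val : onb V -> V)) //.
split=> [i _|i j _ _|v Ev]; [exact: set_valP|exact: val_inj|].
by exists (SigSub (mem_set Ev)).
Qed.

Lemma trace_norm_le A (K : R) : bounded_op A -> positive_op (abs_op A) ->
  (forall F : {fset onb V},
    \sum_(i <- F) inner (val i) (abs_op A (val i)) <= K%:C) ->
  (trace_norm A <= K%:E)%E.
Proof.
move=> Ab Ap HK; rewrite trace_normE //; apply: ge_ereal_sup => _ [X [Xf _] <-].
rewrite fsbig_finite //= sumEFin lee_fin -lecR.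
apply: le_trans (HK (fset_set X)).
rewrite rmorph_sum /= ler_sum // => i _.
by rewrite RRe_real // ger0_real // Ap.2.
Qed.

Lemma trace_norm_ge A (F : {fset onb V}) : bounded_op A -> positive_op (abs_op A) ->
  ((\sum_(i <- F) complex.Re (inner (val i) (abs_op A (val i))))%:E <= trace_norm A)%E.
Proof.
move=> Ab Ap; rewrite trace_normE //; apply: esum_ge; exists [set` F].
  by split=> //; exact: finite_fset.
by rewrite fsbig_finite ?finite_fset //= set_fsetK sumEFin.
Qed.

(* By Parseval and the Cauchy-Schwarz inequality of the form <u, B v>, with
   B = |A|: |B v|^2 <= (sum of the <i, B i>) <v, B v> <= ||A||_1 |v| |B v|. *)
Lemma norm_le_trace_norm A A' (K : R) :
  (forall u v, inner (A' u) v = inner u (A v)) -> bounded_op A ->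
  (trace_norm A <= K%:E)%E -> forall v, `|A v| <= K%:C * `|v|.
Proof.
move=> AA' Ab AK v; have [Bp BA] := abs_opP Ab AA'; rewrite -BA.
set B := abs_op A in Bp BA *.
have HB : `|B v| ^+ 2 <= K%:C * inner v (B v).
  apply: (parseval_le onb_val onb_dense) => F.
  rewrite (@le_trans _ _ (\sum_(i <- F) inner (val i) (B (val i)) * inner v (B v))) //.
    by apply: ler_sum => i _; rewrite -(positive_op_sym Bp) innerC norm_conjC
       innerC norm_conjC (positive_op_sym Bp); exact: positive_op_CS.
  rewrite -mulr_suml ler_wpM2r ?Bp.2 //.
  have := le_trans (trace_norm_ge F Ab Bp) AK; rewrite lee_fin -lecR rmorph_sum.
  apply: le_trans; apply: ler_sum => i _ /=.
  by rewrite RRe_real // ger0_real // Bp.2.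
have K0 : 0 <= K%:C :> C.
  rewrite ler0c -lee_fin (le_trans _ AK) //.
  by have := trace_norm_ge fset0 Ab Bp; rewrite big_seq_fset0.
have [->|Bv0] := eqVneq (B v) 0; first by rewrite normr0 mulr_ge0.
rewrite -(@ler_pM2l _ `|B v|) ?normr_gt0 // -expr2 (le_trans HB) //.
rewrite mulrCA ler_wpM2l // mulrC (le_trans (real_ler_norm _)) ?inner_CS //.
by rewrite ger0_real // Bp.2.
Qed.

Lemma trace_norm_sum_cvg (adj : forall A, bounded_op A ->
    exists A' : V -> V, forall u v, inner (A' u) v = inner u (A v))
    (I : choiceType) (f : I -> V -> V) A v :
  trace_norm_sum f A -> partial_sum f F v @[F --> totally] --> A v.
Proof.
move=> [_ fA]; apply/cvgrPdist_lt => e e0.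
pose d := complex.Re e / (complex.Re `|v| + 1).
have er : (complex.Re e)%:C = e by rewrite RRe_real // gtr0_real.
have vr : (complex.Re `|v|)%:C = `|v| by rewrite RRe_real.
have v0 : 0 <= complex.Re `|v| by rewrite -ler0c vr.
have d0 : 0 < d by rewrite divr_gt0 ?ltr_wpDl // -ltcR er.
have near_d : \forall F \near totally, (trace_norm (A - partial_sum f F)%R < d%:E)%E.
  by apply: (fA [set x | (x < d%:E)%E]); exact: (@nbhs_open_ereal_lt _ 0 (fun=> d)).
apply: filterS near_d => F Fd.
(* [trace_norm] is [+oo] off the bounded operators, so a value below [d] forces boundedness. *)
have Sb : bounded_op (A - partial_sum f F).
  apply: contrapT => nb; move: Fd; rewrite /trace_norm asboolF //.
have [S' HS'] := adj _ Sb.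
rewrite -[X in `|X|]/((A - partial_sum f F) v).
rewrite (le_lt_trans (norm_le_trace_norm HS' Sb (ltW Fd) v)) //.
rewrite -er -vr -rmorphM ltcR /d mulrAC ltr_pdivrMr ?ltr_wpDl //.
by rewrite ltr_pM2l ?ltrDl // -ltcR er.
Qed.

End trace_norm.

(** * Finite diagonal operators are trace class *)

Section diagonal_operators.
Context {R : realType} {V : hilbert_space R} {I : choiceType}.
Local Notation C := R[i].
Implicit Types (u v w : V) (F : {fset I}).
Variables (e : I -> V) (F : {fset I}) (p : I -> C).
Hypothesis eF : orthonormal_on e F.
Hypothesis p0 : forall i, 0 <= p i.

Definition diag_op v : V := \sum_(i <- F) p i *: ketbra (e i) (e i) v.

Lemma diag_op_bounded : bounded_op diag_op.
Proof.
have -> : diag_op = \sum_(i <- F) (fun v => p i *: ketbra (e i) (e i) v).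
  by apply/funext => v; rewrite fct_sumE.
elim/big_ind : _ => [|A B|i _]; first exact: bounded_op0.
  exact: bounded_opD.
by apply: bounded_opZ; exact: bounded_op_ketbra.
Qed.

Lemma diag_op_inner u v :
  inner u (diag_op v) = \sum_(i <- F) p i * (inner u (e i) * inner (e i) v).
Proof.
rewrite /diag_op linear_sum; apply: eq_bigr => i _ /=.
by rewrite /ketbra !innerZr [_ * inner u (e i)]mulrC.
Qed.

Lemma diag_op_positive : positive_op diag_op.
Proof.
split=> [|v]; first exact: diag_op_bounded.
rewrite diag_op_inner sumr_ge0 // => i _.
by rewrite mulr_ge0 // innerC mulrC -normCK exprn_ge0.
Qed.

Hypothesis V_onb : exists E : set V, orthonormal_basis E.

(** The absolute value [B] is estimated rather than computed. With [P] the projection onto the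
    [e i], [B (v - P v)] vanishes because [|B w| = |diag_op w|]; hence [<v, B v> <= K |P v|^2].
    Summed over [onb V], the [|P u|^2] give at most [size F], by exchanging the sums and applying
    Bessel to each [e i]. *)
Lemma diag_op_trace_class : trace_class diag_op.
Proof.
have Ss := positive_op_sym diag_op_positive.
have [Bp BS] := abs_opP diag_op_bounded Ss.
have Bs := positive_op_sym Bp.
have [K K0 HK] := bounded_op_pos diag_op_bounded.
have BP v : abs_op diag_op v = abs_op diag_op (oproj e F v).
  apply/eqP; rewrite -subr_eq0 -(linearP_B Bp.1.1) -normr_eq0 BS normr_eq0.
  rewrite /diag_op big_seq big1 // => i iF.
  by rewrite /ketbra linearB /= inner_proj // subrr scale0r scaler0.
have le_proj v : inner v (abs_op diag_op v) <= K%:C * `|oproj e F v| ^+ 2.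
  rewrite BP -Bs BP (le_trans (real_ler_norm _)) //.
    by rewrite Bs ger0_real // Bp.2.
  rewrite (le_trans (inner_CS _ _)) // BS expr2 mulrA ler_wpM2r //.
suff : (trace_norm diag_op <= (K * (size F)%:R)%:E)%E.
  by move/le_lt_trans; apply; exact: ltry.
apply: trace_norm_le => // [|G]; first exact: diag_op_bounded.
rewrite (@le_trans _ _ (\sum_(u <- G) K%:C * `|oproj e F (val u)| ^+ 2)) //.
  by apply: ler_sum => u _; exact: le_proj.
rewrite -mulr_sumr rmorphM rmorph_nat ler_wpM2l ?ler0c ?(ltW K0) //.
under eq_bigr do rewrite norm_proj //.
rewrite exchange_big /= (@le_trans _ _ (\sum_(i <- F) (1 : C))) //; last first.
  by rewrite big_const_seq count_predT iter_addr addr0.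
rewrite big_seq [leRHS]big_seq; apply: ler_sum => i iF.
have -> : 1 = `|e i| ^+ 2 by rewrite -inner_norm eF // eqxx.
rewrite (le_trans _ (@bessel _ _ _ (val : onb V -> V) G _ _)) //.
  by apply: ler_sum => u _; rewrite innerC norm_conjC.
by move=> u v _ _; exact: onb_val.
Qed.

End diagonal_operators.

Section rank_one.
Context {R : realType} {V : hilbert_space R}.
Local Notation C := R[i].
Hypothesis V_onb : exists E : set V, orthonormal_basis E.
Variables (f : V) (p : C).
Hypothesis f1 : inner f f = 1.

Lemma rank_one_positive : 0 <= p -> positive_op (fun v => p *: ketbra f f v).
Proof.
move=> p0; split=> [|v]; first by apply: bounded_opZ; exact: bounded_op_ketbra.
by rewrite /ketbra !innerZr mulr_ge0 // innerC -normCKC exprn_ge0.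
Qed.

Lemma rank_one_trace_class : 0 <= p ->
  trace_class (fun v => p *: ketbra f f v).
Proof.
move=> p0.
have eF : orthonormal_on (fun _ : unit => f) [fset tt]%fset.
  by move=> [] [] _ _; rewrite f1.
have := @diag_op_trace_class _ _ _ _ _ (fun=> p) eF (fun=> p0) V_onb.
by congr trace_class; apply/funext => v; rewrite /diag_op big_seq_fset1.
Qed.

(** In the arbitrary basis [onb V] the partial traces are [p * <f, P f>] with [P] the finite
    projections, and [P f] tends to [f]. *)
Lemma rank_one_trace : trace (fun v => p *: ketbra f f v) = p.
Proof.
rewrite /trace /summability.sum; apply: (@cvg_lim C^o); first exact: norm_hausdorff.
rewrite -[X in _ --> X]mulr1 -f1.
rewrite (_ : partial_sum _ = (fun F => p * inner f (oproj (val : onb V -> V) F f))).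
  apply: (@cvgZl_tmp C C^o {fset (onb V)} totally _ p
    (fun F => inner f (oproj (val : onb V -> V) F f)) (inner f f)).
  apply: (@cvg_comp _ _ _ _ (inner f : V -> C^o)).
    exact: (proj_cvg (onb_val V_onb) (onb_dense V_onb)).
  exact: inner_continuous.
apply/funext => F; rewrite /oproj linear_sum mulr_sumr /partial_sum.
rewrite [RHS]big_seq_fsetE /=; apply: eq_bigr => i _.
by rewrite /ketbra !innerZr [inner f _ * _]mulrC.
Qed.

End rank_one.

(** * Square-summable families *)

Section complex_convergence.
Context {R : realType}.
Local Notation C := R[i].

Lemma normc_real (x : R) : `|x%:C : C| = (`|x|)%:C.
Proof. by rewrite normc_def /= expr0n /= addr0 sqrtr_sqr. Qed.

(** The partial sums are real and increase along inclusion, so they converge to their supremum. *)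
Lemma cvg_nonneg_sum (J : choiceType) (a : J -> C) (M : R) : (forall i, 0 <= a i) ->
  (forall A : {fset J}, \sum_(i <- A) a i <= M%:C) ->
  exists2 l : C, (fun A : {fset J} => \sum_(i <- A) a i) @ totally --> (l : C^o) &
                 forall A : {fset J}, \sum_(i <- A) a i <= l.
Proof.
move=> a0 aM; pose s (A : {fset J}) := complex.Re (\sum_(i <- A) a i).
have sE A : (s A)%:C = \sum_(i <- A) a i.
  by rewrite RRe_real // ger0_real // sumr_ge0.
have s_sup : has_sup (range s).
  split; first by exists (s fset0); exists fset0.
  by exists M => _ [A _ <-]; rewrite -lecR sE.
have s_le A : s A <= sup (range s) by apply: ub_le_sup; [exact: s_sup.2|exists A].
exists (sup (range s))%:C => [|A]; last by rewrite -sE lecR.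
apply/(@cvgrPdist_lt _ C^o) => e e0.
have er : (complex.Re e)%:C = e by rewrite RRe_real // gtr0_real.
have er0 : 0 < complex.Re e by rewrite -ltcR er.
have [_ [A _ <-] As] := sup_adherent er0 s_sup.
exists A => // B /= AB; rewrite -er -sE -rmorphB normc_real.
rewrite ltcR ger0_norm ?subr_ge0 // ltrBlDr addrC -ltrBlDr.
rewrite (lt_le_trans As) // -lecR !sE [leRHS](big_fsetID _ (mem A)) /=.
rewrite (_ : [fset x in B | x \in A]%fset = A).
  by rewrite lerDl sumr_ge0.
apply/fsetP => x; rewrite !inE /= andbC; case: (boolP (x \in A)) => //= xA.
exact: (fsubsetP AB).
Qed.

Lemma complex_cauchy_cvg (T : Type) (F : set_system T) (a : T -> C) :
  ProperFilter F ->
  (forall e : C, 0 < e -> exists x : C, \forall f \near F, `|x - a f| < e) ->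
  exists l : C, a @ F --> (l : C^o).
Proof.
move=> PF aF.
have coord (p : C -> R) : (forall x y, (`|p x - p y|)%:C <= `|x - y|) ->
    exists l : R, (p \o a) @ F --> l.
  move=> pL; apply/cvg_ex; apply: R_complete; apply: cauchy_exP => e e0.
  have [|x Hx] := aF e%:C; first by rewrite ltcR.
  exists (p x); rewrite /nbhs /=; apply: filterS Hx => f xf.
  by rewrite /= -ball_normE /= -ltcR (le_lt_trans (pL _ _)).
have [r Hr] : exists l : R, (@complex.Re R \o a) @ F --> l.
  by apply: coord => x y; rewrite -raddfB; exact: normc_ge_Re.
have [s Hs] : exists l : R, (@complex.Im R \o a) @ F --> l.
  apply: coord => x y; rewrite -raddfB normc_def lecR -sqrtr_sqr ler_wsqrtr //.
  by rewrite lerDr sqr_ge0.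
exists (r +i* s); apply/(@cvgrPdist_lt _ C^o) => e e0.
have er : (complex.Re e)%:C = e by rewrite RRe_real // gtr0_real.
have e20 : 0 < complex.Re e / 2 by rewrite divr_gt0 // -ltcR er.
have /cvgrPdist_lt /(_ _ e20) Nr := Hr; have /cvgrPdist_lt /(_ _ e20) Ns := Hs.
near=> f.
have fr : `|r - complex.Re (a f)| < complex.Re e / 2 by near: f.
have fs : `|s - complex.Im (a f)| < complex.Re e / 2 by near: f.
rewrite [_ - _]complexE (le_lt_trans (ler_normD _ _)) // normrM normCi mul1r.
rewrite !raddfB /= -er [complex.Re e]splitr rmorphD.
by rewrite -!rmorphB /= !normc_real ltrD // ltcR.
Unshelve. all: by end_near. Qed.

End complex_convergence.

Section square_summable.
Context (R : realType) (J : choiceType).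
Local Notation C := R[i].

(** Square summability is encoded as a real bound uniform over finite sums: closure under the vector
    operations is then a finite inequality, and limits enter only with [l2_dot]. *)
Record l2 := L2 {
  l2_fun :> J -> C;
  l2P : exists M : R, forall A : {fset J}, \sum_(i <- A) `|l2_fun i| ^+ 2 <= M%:C }.

Lemma l2_ext (f g : l2) : (forall i, f i = g i) -> f = g.
Proof.
move: f g => [f fP] [g gP] /= fg; move: (fP) (gP).
by have -> : f = g by [apply/funext => i]; move=> P Q; congr L2; exact: Prop_irrelevance.
Qed.

HB.instance Definition _ := gen_eqMixin l2.
HB.instance Definition _ := gen_choiceMixin l2.

Lemma l2_zero_subproof : exists M : R,
  forall A : {fset J}, \sum_(i <- A) `|0 : C| ^+ 2 <= M%:C.
Proof. by exists 0 => A; rewrite normr0 expr0n big1. Qed.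

Lemma sqr_normD_le (a b : C) : `|a + b| ^+ 2 <= 2 * `|a| ^+ 2 + 2 * `|b| ^+ 2.
Proof.
rewrite -subr_ge0 (_ : _ - _ = `|a - b| ^+ 2) ?exprn_ge0 //.
by rewrite !normCK rmorphB rmorphD /=; ring.
Qed.

Lemma l2_add_subproof (f g : l2) : exists M : R,
  forall A : {fset J}, \sum_(i <- A) `|f i + g i| ^+ 2 <= M%:C.
Proof.
have [M HM] := l2P f; have [N HN] := l2P g; exists (2 * M + 2 * N) => A.
rewrite (le_trans (ler_sum _ (fun i _ => sqr_normD_le _ _))) //.
rewrite big_split -!mulr_sumr rmorphD !rmorphM rmorph_nat.
by rewrite lerD // ler_wpM2l.
Qed.

Lemma l2_scale_subproof (c : C) (f : l2) : exists M : R,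
  forall A : {fset J}, \sum_(i <- A) `|c * f i| ^+ 2 <= M%:C.
Proof.
have [M HM] := l2P f.
have [r rE] : exists r : R, r%:C = `|c| ^+ 2.
  by exists (complex.Re (`|c| ^+ 2)); rewrite RRe_real // ger0_real ?exprn_ge0.
exists (r * M) => A.
under eq_bigr do rewrite normrM exprMn.
rewrite -mulr_sumr rmorphM /= rE.
by rewrite ler_wpM2l ?exprn_ge0.
Qed.

Definition l2_zero := L2 l2_zero_subproof.
Definition l2_add f g := L2 (l2_add_subproof f g).
Definition l2_scale c f := L2 (l2_scale_subproof c f).
Definition l2_opp f := l2_scale (-1) f.

Lemma l2_addA : associative l2_add.
Proof. by move=> f g h; apply: l2_ext => i /=; rewrite addrA. Qed.
Lemma l2_addC : commutative l2_add.
Proof. by move=> f g; apply: l2_ext => i /=; rewrite addrC. Qed.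
Lemma l2_add0 : left_id l2_zero l2_add.
Proof. by move=> f; apply: l2_ext => i /=; rewrite add0r. Qed.
Lemma l2_addN : left_inverse l2_zero l2_opp l2_add.
Proof. by move=> f; apply: l2_ext => i /=; rewrite mulN1r addNr. Qed.

HB.instance Definition _ :=
  GRing.isZmodule.Build l2 l2_addA l2_addC l2_add0 l2_addN.

Lemma l2_scaleA (a b : C) f : l2_scale a (l2_scale b f) = l2_scale (a * b) f.
Proof. by apply: l2_ext => i /=; rewrite mulrA. Qed.
Lemma l2_scale1 : left_id 1 l2_scale.
Proof. by move=> f; apply: l2_ext => i /=; rewrite mul1r. Qed.
Lemma l2_scaleDr : right_distributive l2_scale +%R.
Proof. by move=> c f g; apply: l2_ext => i /=; rewrite mulrDr. Qed.
Lemma l2_scaleDl f : {morph l2_scale^~ f : a b / a + b}.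
Proof. by move=> a b; apply: l2_ext => i /=; rewrite mulrDl. Qed.

HB.instance Definition _ := GRing.Zmodule_isLmodule.Build C l2
  l2_scaleA l2_scale1 l2_scaleDr l2_scaleDl.

Lemma l2_scaleE (c : C) (f : l2) i : (c *: f) i = c * f i. Proof. by []. Qed.

Lemma l2_subE (f g : l2) i : (f - g) i = f i - g i.
Proof. by rewrite -[- g i]mulN1r. Qed.

Definition l2_dot (f g : l2) : C :=
  lim ((fun A : {fset J} => \sum_(i <- A) f i * Num.conj (g i) : C^o) @ totally).

(** Polarisation expresses [f i * Num.conj (g i)] through the squared moduli of [f + g], [f - g],
    [f + j g] and [f - j g] with [j = 'i], whose sums converge because they are bounded. *)
Lemma l2_dot_cvg (f g : l2) :
  (fun A : {fset J} => \sum_(i <- A) f i * Num.conj (g i)) @ totally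
    --> (l2_dot f g : C^o).
Proof.
suff /cvg_ex[l Hl] : cvg ((fun A : {fset J} =>
    \sum_(i <- A) f i * Num.conj (g i) : C^o) @ totally).
  by rewrite /l2_dot (cvg_lim _ Hl).
have sq (h : l2) : exists l : C,
    (fun A : {fset J} => \sum_(i <- A) `|h i| ^+ 2) @ totally --> (l : C^o).
  have [M HM] := l2P h.
  by have [|l Hl _] := cvg_nonneg_sum _ HM; [move=> i; rewrite exprn_ge0|exists l].
have [j j2 cj] : exists2 j : C, j * j = -1 & Num.conj j = - j.
  by exists 'i; [rewrite -expr2 sqrCi|exact: conjCi].
have [a Ha] := sq (f + g); have [b Hb] := sq (f - g).
have [c Hc] := sq (f + j *: g); have [d Hd] := sq (f - j *: g).
have tF : Filter (@totally J) by exact: filter_filter.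
have H1 := @cvgB C C^o _ totally tF _ _ _ _ Ha Hb.
have H2 := @cvgB C C^o _ totally tF _ _ _ _ Hc Hd.
have H3 := @cvgZl_tmp C C^o _ totally tF j _ _ H2.
have H4 := @cvgD C C^o _ totally tF _ _ _ _ H1 H3.
have H5 := @cvgZl_tmp C C^o _ totally tF 4^-1 _ _ H4.
apply/cvg_ex; eexists; apply: (cvg_trans _ H5); apply: near_eq_cvg; apply: nearW.
move=> A /=; rewrite !fctE /=.
rewrite -!sumrB scaler_sumr -big_split scaler_sumr /=.
apply: eq_bigr => i _; rewrite !mulN1r !normCK !rmorphD !rmorphN !rmorphM /= cj.
rewrite /GRing.scale /=.
move: (f i) (g i) (Num.conj (f i)) (Num.conj (g i)) => x y x' y'.
transitivity (4^-1 * (2 * (1 - j * j) * (x * y') + 2 * (1 + j * j) * (y * x'))).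
  by ring.
by rewrite j2; field.
Qed.

End square_summable.

Section l2_inner_product.
Context {R : realType} {J : choiceType}.
Local Notation C := R[i].
Implicit Types (f g h : l2 R J) (c : C).

Lemma l2_dotP f g (l : C) :
  (fun A : {fset J} => \sum_(i <- A) f i * Num.conj (g i)) @ totally --> (l : C^o) ->
  l2_dot f g = l.
Proof.
move=> Hl; apply: (@cvg_lim C^o _ _ totally) Hl; exact: norm_hausdorff.
Qed.

Lemma l2_dot_sq f : exists2 l : C, l2_dot f f = l &
  forall A : {fset J}, \sum_(i <- A) `|f i| ^+ 2 <= l.
Proof.
have [M HM] := l2P f.
have [|l Hl lA] := cvg_nonneg_sum _ HM; first by move=> i; rewrite exprn_ge0.
exists l => //; apply: l2_dotP; apply: cvg_trans Hl; apply: near_eq_cvg.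
by apply: nearW => A; apply: eq_bigr => i _; rewrite normCK.
Qed.

Lemma l2_dotC f g : l2_dot g f = Num.conj (l2_dot f g).
Proof.
apply: l2_dotP; apply/(@cvgrPdist_lt _ C^o) => e e0.
have /(@cvgrPdist_lt _ C^o) /(_ e e0) := @l2_dot_cvg _ _ f g.
apply: filterS => A /=; rewrite -norm_conjC rmorphB rmorph_sum /=.
congr (`|_ - _| < _); apply: eq_bigr => i _.
by rewrite rmorphM /= conjCK mulrC.
Qed.

Lemma l2_dot_scalar g : scalar (fun f => l2_dot f g).
Proof.
move=> c f h; apply: l2_dotP.
have tF : Filter (@totally J) by exact: filter_filter.
have H1 := @cvgZl_tmp C C^o _ totally tF c _ _ (@l2_dot_cvg _ _ f g).
have H2 := @cvgD C C^o _ totally tF _ _ _ _ H1 (@l2_dot_cvg _ _ h g).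
apply: (cvg_trans _ H2); apply: near_eq_cvg; apply: nearW => A /=.
rewrite !fctE /= /GRing.scale /= mulr_sumr -big_split /=.
by apply: eq_bigr => i _; rewrite mulrA -mulrDl.
Qed.

Lemma l2_dot_ge0 f : 0 <= l2_dot f f.
Proof. by have [l -> /(_ fset0)] := l2_dot_sq f; rewrite big_seq_fset0. Qed.

Lemma l2_dot_ge f (A : {fset J}) : \sum_(i <- A) `|f i| ^+ 2 <= l2_dot f f.
Proof. by have [l -> lA] := l2_dot_sq f. Qed.

Lemma l2_dot_le f (K : C) :
  (forall A : {fset J}, \sum_(i <- A) `|f i| ^+ 2 <= K) -> l2_dot f f <= K.
Proof.
move=> HK; rewrite -[leLHS]ger0_norm ?l2_dot_ge0 //.
apply: (@cvg_norm_le R C^o _ totally _ _ _ _ _ (@l2_dot_cvg _ _ f f)).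
apply: nearW => A; rewrite ger0_norm; last first.
  by apply: sumr_ge0 => i _; rewrite -normCK exprn_ge0.
by under eq_bigr do rewrite -normCK.
Qed.

Lemma l2_dot_eq0 f : l2_dot f f = 0 -> f = 0.
Proof.
move=> f0; apply: l2_ext => i; apply/eqP; rewrite -normr_eq0 -sqrf_eq0.
have := l2_dot_ge f [fset i]%fset; rewrite f0 big_seq_fset1 => H.
by rewrite eq_le H exprn_ge0.
Qed.

Lemma l2_dot_scalar_r g c f h :
  l2_dot g (c *: f + h) = Num.conj c * l2_dot g f + l2_dot g h.
Proof. by rewrite l2_dotC l2_dot_scalar rmorphD rmorphM /= -!l2_dotC. Qed.

Definition l2_norm f : C := sqrtC (l2_dot f f).

Lemma sqr_l2_norm f : l2_norm f ^+ 2 = l2_dot f f. Proof. exact: sqrtCK. Qed.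

Lemma l2_norm_ge0 f : 0 <= l2_norm f.
Proof. by rewrite sqrtC_ge0 l2_dot_ge0. Qed.

Lemma l2_normZ c f : l2_norm (c *: f) = `|c| * l2_norm f.
Proof.
apply/eqP; rewrite -(@eqrXn2 _ 2) ?mulr_ge0 ?l2_norm_ge0 //.
have Z (g h : l2 R J) : l2_dot (c *: g) h = c * l2_dot g h.
  have Z0 : l2_dot 0 h = 0.
    have := l2_dot_scalar h 1 0 0; rewrite scaler0 addr0 /= mul1r => E.
    by apply: (@addrI _ (l2_dot 0 h)); rewrite addr0 -E.
  by have := l2_dot_scalar h c g 0; rewrite /= !addr0 Z0 addr0.
by rewrite exprMn !sqr_l2_norm Z l2_dotC Z rmorphM /= -l2_dotC mulrA -normCK.
Qed.

Lemma l2_CS f g : `|l2_dot f g| <= l2_norm f * l2_norm g.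
Proof.
rewrite -(@ler_pXn2r _ 2) ?nnegrE ?mulr_ge0 ?l2_norm_ge0 //.
rewrite exprMn !sqr_l2_norm l2_dotC norm_conjC.
apply: (sesquilinear_CS (f := fun u v => l2_dot v u)).
- exact: l2_dot_scalar.
- by move=> u v; exact: l2_dotC.
- exact: l2_dot_ge0.
Qed.

Lemma l2_normD f g : l2_norm (f + g) <= l2_norm f + l2_norm g.
Proof.
rewrite -(@ler_pXn2r _ 2) ?nnegrE ?addr_ge0 ?l2_norm_ge0 //.
rewrite sqrrD !sqr_l2_norm.
have D (u v w : l2 R J) : l2_dot (u + v) w = l2_dot u w + l2_dot v w.
  by have := l2_dot_scalar w 1 u v; rewrite /= scale1r mul1r.
have Dr (u v w : l2 R J) : l2_dot w (u + v) = l2_dot w u + l2_dot w v.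
  by rewrite l2_dotC D rmorphD /= -!l2_dotC.
have cross : l2_dot f g + l2_dot g f <= (l2_norm f * l2_norm g) *+ 2.
  rewrite (le_trans (real_ler_norm _)) //.
    by rewrite CrealE rmorphD /= -!l2_dotC addrC.
  rewrite (le_trans (ler_normD _ _)) // mulr2n lerD ?l2_CS //.
  by rewrite [leRHS]mulrC l2_CS.
rewrite D !Dr (_ : _ + _ = l2_dot f f + (l2_dot f g + l2_dot g f) + l2_dot g g);
  last ring.
by rewrite lerD2r lerD2l.
Qed.

Lemma l2_norm_eq0 f : l2_norm f = 0 -> f = 0.
Proof. by move=> f0; apply: l2_dot_eq0; rewrite -sqr_l2_norm f0 expr0n. Qed.

HB.instance Definition _ := Lmodule_isNormed.Build C (l2 R J)
  l2_normD l2_normZ l2_norm_eq0.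

End l2_inner_product.

(** * Completeness of [l^2] *)

Section l2_complete.
Context {R : realType} {J : choiceType}.
Local Notation C := R[i].
Implicit Types (f g h : l2 R J) (c : C).

Lemma l2_norm_ge f (A : {fset J}) : \sum_(i <- A) `|f i| ^+ 2 <= `|f| ^+ 2.
Proof. by rewrite [leRHS]sqr_l2_norm l2_dot_ge. Qed.

Lemma l2_norm_le f (K : C) : 0 <= K ->
  (forall A : {fset J}, \sum_(i <- A) `|f i| ^+ 2 <= K ^+ 2) -> `|f| <= K.
Proof.
move=> K0 HK; rewrite -(@ler_pXn2r _ 2) ?nnegrE //.
by rewrite [leLHS]sqr_l2_norm l2_dot_le.
Qed.

Lemma l2_coord_le f i : `|f i| <= `|f|.
Proof.
rewrite -(@ler_pXn2r _ 2) ?nnegrE // (le_trans _ (l2_norm_ge f [fset i]%fset)) //.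
by rewrite big_seq_fset1.
Qed.

(** The limit [g] is taken coordinatewise. Bounds on finite sums survive the limit ([close]), which
    shows both that [g] is square summable and that it lies within [e] of every centre [x] whose
    ball of radius [e] belongs to [F]. *)
Lemma l2_complete (F : set_system (l2 R J)) : ProperFilter F -> cauchy F -> cvg F.
Proof.
move=> PF /cauchyP Fc; have FF : Filter F by exact: filter_filter.
have coord i : exists l : C, (fun f : l2 R J => f i) @ F --> (l : C^o).
  apply: complex_cauchy_cvg => e e0; have [x Hx] := Fc e e0; exists (x i).
  apply: filterS Hx => f; rewrite -ball_normE /=; apply: le_lt_trans.
  by rewrite -l2_subE; exact: l2_coord_le.
pose g i := projT1 (cid (coord i)).
have Hg i : (fun f : l2 R J => f i) @ F --> (g i : C^o) by exact: projT2 (cid (coord i)).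
have close (x : l2 R J) (e : C) : 0 < e -> F (ball x e) -> forall A : {fset J},
    \sum_(i <- A) `|g i - x i| ^+ 2 <= e ^+ 2.
  move=> e0 Fx A; rewrite -[leLHS]ger0_norm; last first.
    by apply: sumr_ge0 => i _; rewrite exprn_ge0.
  apply: (@cvg_norm_le R C^o _ F (fun f => \sum_(i <- A) `|f i - x i| ^+ 2)) => //.
    apply: filterS Fx => f; rewrite -ball_normE /= => xf.
    rewrite ger0_norm; last by apply: sumr_ge0 => i _; rewrite exprn_ge0.
    under eq_bigr do rewrite -l2_subE.
    rewrite (le_trans (l2_norm_ge (f - x) A)) //.
    by rewrite ler_pXn2r ?nnegrE ?(ltW e0) // distrC ltW.
  have step i : (fun f : l2 R J => `|f i - x i| ^+ 2) @ F --> (`|g i - x i| ^+ 2 : C^o).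
    have d : (fun f : l2 R J => f i - x i) @ F --> (g i - x i : C^o).
      by apply: (@cvgB C C^o _ F _ _ _ _ _ (Hg i)); exact: (@cvg_cst C^o).
    have n := @cvg_norm C C^o _ F FF _ _ d.
    by have := @cvgM C _ F FF _ _ _ _ n n.
  elim: (A : seq J) => [|i r IH].
    rewrite big_nil; under eq_fun do rewrite big_nil.
    exact: (@cvg_cst C^o).
  rewrite big_cons; under eq_fun do rewrite big_cons.
  exact: (@cvgD C C^o _ F FF _ _ _ _ (step i) IH).
have [x0 Fx0] := Fc 1 ltr01.
have gP : exists M : R, forall A : {fset J}, \sum_(i <- A) `|g i| ^+ 2 <= M%:C.
  have [M HM] := l2P x0; exists (2 * 1 + 2 * M) => A.
  rewrite (eq_bigr (fun i => `|(g i - x0 i) + x0 i| ^+ 2)); last first.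
    by move=> i _; rewrite subrK.
  rewrite (le_trans (ler_sum _ (fun i _ => sqr_normD_le _ _))) //.
  rewrite big_split -!mulr_sumr rmorphD !rmorphM rmorph_nat rmorph1 /=.
  by rewrite lerD // ler_wpM2l // (le_trans (close x0 1 ltr01 Fx0 A)) // expr1n.
apply/cvg_ex; exists (L2 gP); apply/cvgrPdist_le => e e0.
have e20 : 0 < e / 2 by rewrite divr_gt0.
have [x Fx] := Fc _ e20; apply: filterS (Fx) => f.
rewrite -ball_normE /= => xf; rewrite -(subrKA x) (le_trans (ler_normD _ _)) //.
rewrite [e in leRHS]splitr lerD // ?(ltW xf) //.
apply: l2_norm_le => [|A]; first exact: ltW.
under eq_bigr do rewrite l2_subE.
exact: close.
Qed.

HB.instance Definition _ := Uniform_isComplete.Build (l2 R J) l2_complete.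

Lemma l2_dot_zmodl h : zmod_morphism (fun f => l2_dot f h).
Proof.
move=> f g; have := l2_dot_scalar h (-1) g f.
by rewrite scaleN1r [- g + f]addrC mulN1r [- _ + _]addrC => ->.
Qed.

Lemma l2_dot_zmodr h : zmod_morphism (l2_dot h).
Proof.
move=> f g; have := l2_dot_scalar_r h (-1) g f.
by rewrite scaleN1r [- g + f]addrC rmorphN rmorph1 mulN1r [- _ + _]addrC => ->.
Qed.

Lemma l2_dotZl h : scalable_for *%R (fun f => l2_dot f h).
Proof.
move=> c f; have := l2_dot_scalar h c f 0.
have l0 : l2_dot 0 h = 0 by have := l2_dot_zmodl h 0 0; rewrite !subrr.
by rewrite /= l0 !addr0.
Qed.

Lemma l2_dotZr h : scalable_for (Num.conj \; *%R) (l2_dot h).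
Proof.
move=> c f; have := l2_dot_scalar_r h c f 0.
have l0 : l2_dot h 0 = 0 by have := l2_dot_zmodr h 0 0; rewrite !subrr.
by rewrite /= l0 !addr0.
Qed.

HB.instance Definition _ := sesquilinear.isBilinear.Build C (l2 R J) (l2 R J) C
  *%R (@Num.conj C \; *%R) (@l2_dot R J) l2_dot_zmodl l2_dot_zmodr l2_dotZl l2_dotZr.

Lemma l2_dot_hermitian (f g : l2 R J) :
  l2_dot f g = (-1) ^+ false * Num.conj (l2_dot g f).
Proof. by rewrite expr0 mul1r l2_dotC. Qed.

HB.instance Definition _ := sesquilinear.isHermitianSesquilinear.Build C (l2 R J)
  false (@Num.conj C) (@l2_dot R J) l2_dot_hermitian.

Lemma l2_dot_gt0 (f : l2 R J) : f != 0 -> 0 < l2_dot f f.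
Proof.
move=> f0; rewrite lt_def l2_dot_ge0 andbT; apply: contraNneq f0 => /l2_dot_eq0 -> //.
Qed.

HB.instance Definition _ := sesquilinear.isDotProduct.Build C (l2 R J)
  (@l2_dot R J) l2_dot_gt0.

End l2_complete.

Definition l2_space (R : realType) (J : choiceType) : hilbert_space R :=
  @HilbertSpace R (l2 R J) (@l2_dot R J) (@sqr_l2_norm R J).

(** * The standard basis of [l^2] and the adjoints it provides *)

Section l2_basis.
Context {R : realType} {J : choiceType}.
Local Notation C := R[i].
Local Notation V := (l2_space R J).
Implicit Types (f g h : V) (c : C).

Lemma l2_delta_subproof (i : J) : exists M : R,
  forall A : {fset J}, \sum_(j <- A) `|(j == i)%:R : C| ^+ 2 <= M%:C.
Proof.
exists 1 => A; have [iA|iA] := boolP (i \in A).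
  rewrite (big_fsetD1 i) //= eqxx normr1 expr1n big_seq big1 ?addr0 //.
  by move=> j; rewrite in_fsetD1 => /andP[/negPf -> _]; rewrite normr0 expr0n.
rewrite big_seq big1 ?ler0c // => j jA; rewrite (_ : j == i = false).
  by rewrite normr0 expr0n.
by apply: contraNF iA => /eqP <-.
Qed.

Definition l2_delta (i : J) : V := L2 (l2_delta_subproof i).

Lemma inner_delta i (f : V) : inner (l2_delta i) f = (f : l2 R J) i.
Proof.
apply: l2_dotP; apply/(@cvgrPdist_lt _ C^o) => e e0; exists [fset i]%fset => // A /=.
rewrite fsub1set => iA; rewrite (big_fsetD1 i) //= eqxx rmorph1 mulr1.
rewrite big_seq big1 ?addr0 ?subrr ?normr0 // => j.
by rewrite in_fsetD1 => /andP[/negPf -> _]; rewrite rmorph0 mulr0.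
Qed.

Lemma l2_delta_orthonormal i j : inner (l2_delta i) (l2_delta j) = (i == j)%:R.
Proof. exact: inner_delta. Qed.

(** By Pythagoras [|f - P f|^2] is [|f|^2] minus a finite sum of the [|f i|^2], and these sums tend
    to [l2_dot f f = |f|^2]. *)
Lemma l2_delta_dense : dense (lin_span (range l2_delta)).
Proof.
move=> O [f Of] Oo; have /nbhs_ballP[d /= d0 dO] := open_nbhs_nbhs (conj Oo Of).
have d20 : 0 < d ^+ 2 by rewrite exprn_gt0.
have /(@cvgrPdist_lt _ C^o) /(_ _ d20) [A _ /(_ A (fsubset_refl _)) /= HA] :=
  @l2_dot_cvg R J f f.
exists (oproj l2_delta A f); split.
  apply: dO; rewrite -ball_normE /= -(@ltr_pXn2r _ 2) ?nnegrE ?(ltW d0) //.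
  have oA : orthonormal_on l2_delta A by move=> i j _ _; exact: l2_delta_orthonormal.
  apply: le_lt_trans HA; rewrite -sqr_l2_norm -[l2_norm f]/(`|f|).
  rewrite (pythagoras f oA) norm_proj //.
  rewrite (eq_bigr (fun i => `|inner (l2_delta i) f| ^+ 2)); last first.
    by move=> i _; rewrite inner_delta.
  rewrite [X in _ + _ - X](eq_bigr (fun i => `|inner (l2_delta i) f| ^+ 2)); last first.
    by move=> i _; rewrite inner_delta normCK.
  by rewrite [X in X - _]addrC addrK ger0_norm // exprn_ge0.
exists [seq (inner (l2_delta i) f, l2_delta i) | i <- A].
  by move=> p /mapP[i _ ->]; exists i.
by rewrite big_map.
Qed.

Lemma l2_delta_inj : injective l2_delta.
Proof.
move=> i j /(congr1 (fun f => inner (l2_delta i) f)).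
rewrite !l2_delta_orthonormal eqxx => /esym/eqP.
by have [//|_ /=] := eqVneq i j; rewrite eq_sym oner_eq0.
Qed.

Lemma l2_delta_onb : orthonormal_basis (range l2_delta).
Proof.
split=> [_ _ [i _ <-] [j _ <-]|]; last exact: l2_delta_dense.
by rewrite l2_delta_orthonormal (inj_eq l2_delta_inj).
Qed.

Lemma l2_has_onb : exists E : set V, orthonormal_basis E.
Proof. by exists (range l2_delta); exact: l2_delta_onb. Qed.

(** The vector [w] with coordinates [<A e_i, u>] on [F] satisfies [<A w, u> = |w|^2]; hence
    [|w|^2 <= M |w| |u|], and [|w| <= M |u|] uniformly in [F]. *)
Lemma l2_adjoint_subproof (A : V -> V) (u : V) : bounded_op A -> exists M : R,
  forall F : {fset J}, \sum_(i <- F) `|inner (A (l2_delta i)) u| ^+ 2 <= M%:C.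
Proof.
move=> Ab; have [M M0 HM] := bounded_op_pos Ab.
have [r rE] : exists r : R, r%:C = `|u|.
  by exists (complex.Re `|u|); rewrite RRe_real.
have r0 : 0 <= r by rewrite -ler0c rE.
exists ((M * r) ^+ 2) => F.
pose c i := inner (A (l2_delta i)) u; pose w : V := \sum_(i <- F) c i *: l2_delta i.
have oF : orthonormal_on l2_delta F by move=> i j _ _; exact: l2_delta_orthonormal.
have cw i : i \in F -> inner (l2_delta i) w = c i.
  move=> iF; rewrite linear_sum (big_fsetD1 i) //= innerZr l2_delta_orthonormal.
  rewrite eqxx mulr1 big_seq big1 ?addr0 // => j; rewrite in_fsetD1 => /andP[ji _].
  by rewrite innerZr l2_delta_orthonormal eq_sym (negPf ji) mulr0.
have wE : oproj l2_delta F w = w.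
  by rewrite /oproj big_seq [RHS]big_seq; apply: eq_bigr => i /cw ->.
have normw : `|w| ^+ 2 = \sum_(i <- F) `|c i| ^+ 2.
  rewrite -{1}wE norm_proj // big_seq [RHS]big_seq.
  by apply: eq_bigr => i /cw ->.
have innerw : inner (A w) u = `|w| ^+ 2.
  rewrite normw /w (linearP_sum Ab.1) inner_suml; apply: eq_bigr => i _.
  by rewrite (linearP_Z Ab.1) innerZl mulrC -normCK.
rewrite -normw rmorphXn ler_pXn2r ?nnegrE //; last first.
  by rewrite ler0c mulr_ge0 // ltW.
have [->|w0] := eqVneq w 0.
  by rewrite normr0 ler0c mulr_ge0 // ltW.
rewrite -(@ler_pM2l _ `|w|) ?normr_gt0 // -expr2 -innerw.
rewrite (le_trans (real_ler_norm _)) ?innerw ?ger0_real ?exprn_ge0 //.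
rewrite -innerw (le_trans (inner_CS _ _)) // rmorphM /= rE mulrA ler_wpM2r //.
by rewrite mulrC.
Qed.

(** The coordinates of [A' u] are forced to be [<A e_i, u>]. The identity then holds on finite
    combinations of the [e_i] and reaches every [v] by density. *)
Lemma l2_adjoint_exists (A : V -> V) : bounded_op A ->
  exists A' : V -> V, forall u v, inner (A' u) v = inner u (A v).
Proof.
move=> Ab; have [M M0 HM] := bounded_op_pos Ab.
exists (fun u => (L2 (l2_adjoint_subproof u Ab) : V)) => u v.
set u' : V := L2 _.
have Hd i : inner u' (l2_delta i) = inner u (A (l2_delta i)).
  by rewrite innerC inner_delta -innerC.
apply/eqP; rewrite -subr_eq0 -normr_le0.
have : forall e : C, 0 < e -> `|inner u' v - inner u (A v)| <= e.
  (* [K] bounds the error per unit of [|v - P v|]; the added 1 keeps it positive. *)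
  move=> e e0; pose K := `|u'| + `|u| * M%:C + 1.
  have K0 : 0 < K by rewrite ltr_wpDl // addr_ge0 // mulr_ge0 // ler0c ltW.
  have eK : 0 < e / K by rewrite divr_gt0.
  have [F /(_ F (fsubset_refl _)) HF] :=
    dist_proj_lt l2_delta_orthonormal l2_delta_dense v eK.
  have -> : inner u' v - inner u (A v) =
      inner u' (v - oproj l2_delta F v) - inner u (A (v - oproj l2_delta F v)).
    have HP : inner u' (oproj l2_delta F v) = inner u (A (oproj l2_delta F v)).
      rewrite /oproj (linearP_sum Ab.1) !linear_sum; apply: eq_bigr => i _.
      by rewrite (linearP_Z Ab.1) /= !innerZr Hd.
    rewrite (linearP_B Ab.1) [inner u' (v - _)]linearB [inner u (_ - _)]linearB /= HP.
    by rewrite opprB addrA subrK.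
  move: (v - _) HF => d dK; rewrite (le_trans (ler_normB _ _)) //.
  rewrite (@le_trans _ _ (K * `|d|)) //; last first.
    by rewrite -ler_pdivlMl // mulrC ltW.
  rewrite !mulrDl -[leLHS]addr0 lerD ?mul1r // lerD ?inner_CS // -mulrA.
  by rewrite (le_trans (inner_CS _ _)) // ler_wpM2l.
move=> small; rewrite real_leNgt ?ger0_real //; apply/negP => x0.
have := small (`|inner u' v - inner u (A v)| / 2) (divr_gt0 x0 (ltr0Sn _ 1)).
by rewrite real_leNgt ?ger0_real ?divr_ge0 // ltr_pdivrMr // mulr_natr mulr2n
   ltrDl x0.
Qed.

End l2_basis.

Lemma l2_unit_separable (R : realType) : separable (l2_space R unit).
Proof.
pose s (p : rat * rat) : l2_space R unit :=
  (ratr p.1 +i* ratr p.2 : R[i]) *: l2_delta tt.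
exists (range s); first exact: sub_countable (card_image_le _ _) (countableP _).
move=> O [f Of] Oo; have /nbhs_ballP[d /= d0 dO] := open_nbhs_nbhs (conj Oo Of).
have dr : (complex.Re d)%:C = d by rewrite RRe_real // gtr0_real.
have d20 : 0 < complex.Re d / 2 by rewrite divr_gt0 // -ltcR dr.
have approx (x : R) : exists q : rat, `|x - ratr q| < complex.Re d / 2.
  have [|q] := @rat_in_itvoo R (x - complex.Re d / 2) (x + complex.Re d / 2).
    by rewrite ltrBlDr -addrA ltrDl addr_gt0.
  by rewrite in_itv /= => xq; exists q; rewrite distrC ltr_distl.
pose z : R[i] := inner (l2_delta tt) f.
have fE : f = z *: l2_delta tt.
  by apply: l2_ext => -[]; rewrite l2_scaleE /z inner_delta /= mulr1.
have [p Hp] := approx (complex.Re z); have [q Hq] := approx (complex.Im z).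
exists (s (p, q)); split; last by exists (p, q).
apply: dO; rewrite -ball_normE /= {1}fE /s -scalerBl normrZ.
have -> : `|l2_delta tt : l2_space R unit| = 1.
  apply/eqP; rewrite -(@eqrXn2 _ 2) // -inner_norm l2_delta_orthonormal.
  by rewrite eqxx expr1n.
rewrite mulr1 [_ - _]complexE (le_lt_trans (ler_normD _ _)) // normrM normCi mul1r.
rewrite !raddfB /= -dr [complex.Re d]splitr rmorphD.
by rewrite -!rmorphB /= !normc_real ltrD // ltcR.
Qed.

(** * Trace norm sums with eventually constant partial sums *)

Section trace_norm_sum.
Context {R : realType} {J I : choiceType}.
Local Notation C := R[i].
Local Notation V := (l2_space R J).
Implicit Types (f : I -> V -> V) (A S : V -> V).

Lemma trace_norm0 : trace_norm (0 : V -> V) = 0%E.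
Proof.
have b0 : bounded_op (0 : V -> V) := bounded_op0.
rewrite (trace_normE b0); apply: esum1 => i _.
have [_ B0] := @abs_opP _ V 0 0 b0
  (fun u v => etrans (inner0l v) (esym (linear0 (inner u)))).
have /eqP := B0 (val i); rewrite normr0 normr_eq0 => /eqP ->.
by rewrite linear0.
Qed.

Lemma trace_class_bounded A : trace_class A -> bounded_op A.
Proof.
move=> tA; apply: contrapT => nb.
by move: tA; rewrite /trace_class /trace_norm asboolF.
Qed.

Lemma trace_norm_sum_near f S : trace_class S ->
  (\forall F \near totally, partial_sum f F = S) -> trace_norm_sum f S.
Proof.
move=> tS Sf; split=> //; apply: cvg_near_cst; apply: filterS Sf => F ->.
by rewrite subrr trace_norm0.
Qed.

(** The tool that identifies limits selected by [xget]: convergence in trace norm gives convergence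
    at the vector [v], where limits are unique. *)
Lemma trace_norm_sum_unique f A v w : trace_norm_sum f A ->
  (\forall F \near totally, partial_sum f F v = w) -> A v = w.
Proof.
move=> fA fw.
have Av : partial_sum f F v @[F --> totally] --> A v.
  exact (@trace_norm_sum_cvg R V (@l2_has_onb R J) (@l2_adjoint_exists R J) I f A v fA).
have := @cvg_lim V (@norm_hausdorff _ V) _ totally _ _ _ Av => <-.
apply: (@cvg_lim V (@norm_hausdorff _ V)).
apply/cvgrPdist_lt => e e0; apply: filterS fw => F ->.
by rewrite subrr normr0.
Qed.

Lemma partial_sumE f (F : {fset I}) v :
  partial_sum f F v = \sum_(i <- F) f i v.
Proof. by rewrite /partial_sum fct_sumE [RHS]big_seq_fsetE. Qed.

End trace_norm_sum.

(** * The Markov walk with a one-dimensional coin *)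

Section one_dimensional_coin.
Context {R : realType} {J : choiceType}.
Local Notation C := R[i].
Local Notation coin := (l2_space R unit).
Local Notation V := (l2_space R J).
Local Notation d := (l2_delta (tt : unit) : coin).

(** The coin C is realised as [l^2] over [unit], so that the results on [l^2] apply to it too; the
    identification with C reads off the only coordinate. *)
Definition scalar_of (h : coin) : C := (h : l2 R unit) tt.

Lemma scalar_ofE h : h = scalar_of h *: d.
Proof. by apply: l2_ext => -[]; rewrite l2_scaleE /= mulr1. Qed.

Lemma inner_scalar_of (h h' : coin) :
  inner h h' = Num.conj (scalar_of h) * scalar_of h'.
Proof.
rewrite {1}[h]scalar_ofE {1}[h']scalar_ofE innerZl innerZr l2_delta_orthonormal.
by rewrite eqxx mulr1.
Qed.

Definition scalar_pure (h : coin) (v : V) : V := scalar_of h *: v.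

Lemma scalar_pure_linear_l v : linear (scalar_pure^~ v).
Proof. by move=> c h h'; rewrite /scalar_pure scalerA -scalerDl. Qed.

Lemma scalar_pure_linear_r h : linear (scalar_pure h).
Proof. by move=> c v w; rewrite /scalar_pure scalerDr !scalerA mulrC. Qed.

Lemma scalar_pure_inner h h' v v' :
  inner (scalar_pure h v) (scalar_pure h' v') = inner h h' * inner v v'.
Proof. by rewrite innerZl innerZr inner_scalar_of mulrA. Qed.

Lemma scalar_pure_delta v : scalar_pure d v = v.
Proof. exact: scale1r. Qed.

Lemma scalar_pure_dense :
  dense (lin_span [set t | exists h v, t = scalar_pure h v]).
Proof.
move=> O [v Ov] _; exists v; split=> //; exists [:: (1, v)].
  by move=> p; rewrite inE => /eqP -> /=; exists d, v; rewrite scalar_pure_delta.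
by rewrite big_seq1 scale1r.
Qed.

Definition scalar_tensor : hilbert_tensor coin V :=
  HilbertTensor scalar_pure_linear_l scalar_pure_linear_r scalar_pure_inner
    scalar_pure_dense.

Lemma coin_op_scalar (A : coin -> coin) : linear A ->
  A = fun h => scalar_of (A d) *: h.
Proof.
move=> Al; apply/funext => h; rewrite {1}[h]scalar_ofE (linearP_Z Al).
by rewrite {1}[A d]scalar_ofE scalerA mulrC -scalerA -scalar_ofE.
Qed.

(** Every [v] is the pure tensor of [l2_delta tt] and [v], so the condition on pure tensors already
    fixes the operator that [xget] selects. *)
Lemma scalar_tensor_op (a : C) (B : V -> V) : bounded_op B ->
  tensor_op scalar_tensor (fun h => a *: h) B = fun v => a *: B v.
Proof.
move=> Bb; rewrite /tensor_op.
set P := [set _ | _].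
have : P (fun v => a *: B v).
  split; first exact: bounded_opZ.
  by move=> h v; rewrite /= /scalar_pure (linearP_Z Bb.1) scalerA.
move=> /(xgetI (fun=> 0)); set T := xget _ _ => -[_ TE]; apply/funext => v.
have := TE d v; rewrite /= scalar_pure_delta => ->.
by rewrite /scalar_pure /scalar_of /= mulr1.
Qed.

End one_dimensional_coin.

(** * The walk of a finitely supported Markov kernel *)

Section markov_walk.
Context {R : realType} {D : distance_set}.
Local Notation C := R[i].
(* [q k j i] is the probability that the map M_k moves the walker from [j] to
   [i]. *)
Variable q : D -> D -> D -> C.
Hypothesis q_ge0 : forall k j i, 0 <= q k j i.
Hypothesis q_fin : forall k j, exists A : {fset D}, forall i, q k j i != 0 -> i \in A.
Hypothesis q_sum : forall k j (A : {fset D}),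
  (forall i, q k j i != 0 -> i \in A) -> \sum_(i <- A) q k j i = 1.
Hypothesis q_unit : forall k i, q k (dzero D) i = (i == k)%:R.

Definition markov_op (i j k : D) (h : l2_space R unit) : l2_space R unit :=
  sqrtC (q k j i) *: h.

Lemma sqrt_q_conj k j i : Num.conj (sqrtC (q k j i)) = sqrtC (q k j i).
Proof. by apply/CrealP; rewrite ger0_real // sqrtC_ge0. Qed.

Lemma markov_op_bounded i j k : bounded_op (markov_op i j k).
Proof. exact: bounded_opZ bounded_op_id. Qed.

Lemma markov_op_sum (j k : D) (h : l2_space R unit) :
  partial_sum (fun i : D => adjoint (markov_op i j k) (markov_op i j k h)) F
    @[F --> totally] --> h.
Proof.
have [A HA] := q_fin k j.
apply/cvgrPdist_lt => e e0; exists A => // F /= AF.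
rewrite /partial_sum (_ : \sum_(_ : _) _ = h) ?subrr ?normr0 //.
rewrite -(big_seq_fsetE _ F xpredT
  (fun i => adjoint (markov_op i j k) (markov_op i j k h))) /=.
under eq_bigr => i _.
  rewrite adjoint_scale /markov_op scalerA sqrt_q_conj -expr2 sqrtCK; over.
rewrite -scaler_suml q_sum ?scale1r // => i /HA; exact: (fsubsetP AF).
Qed.

Definition markov_walk : oqrw R D :=
  @OQRW R D (l2_space R unit) (l2_unit_separable R) (l2_space R D) (@l2_delta R D)
    (@l2_delta_inj R D) (@l2_delta_onb R D) scalar_tensor markov_op
    markov_op_bounded markov_op_sum.

Local Notation V := (l2_space R D).
Local Notation e := (@l2_delta R D).

Lemma markov_step_op i j k :
  step_op (w := markov_walk) i j k = fun v : V => sqrtC (q k j i) *: ketbra (e i) (e j) v.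
Proof. by apply: scalar_tensor_op; exact: bounded_op_ketbra. Qed.

Lemma markov_summand k l i j (v : V) :
  (step_op (w := markov_walk) i j k \o ketbra (e l) (e l) \o
   adjoint (step_op (w := markov_walk) i j k)) v =
  (if j == l then q k l i else 0) *: ketbra (e i) (e i) v.
Proof.
rewrite markov_step_op adjoint_ketbra sqrt_q_conj /= /ketbra.
rewrite !innerZr !l2_delta_orthonormal !scalerA [l == j]eq_sym.
case: eqVneq => [->|]; last by rewrite !(mulr0, mul0r) scale0r.
by rewrite !mulr1 mulrA -expr2 sqrtCK.
Qed.

Lemma orthonormal_on_delta (A : {fset D}) : orthonormal_on e A.
Proof. by move=> i j _ _; exact: l2_delta_orthonormal. Qed.

(** In the sum over pairs only [(i, l)] with [q k l i != 0] contributes, so the partial sums are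
    constant once they contain all [(i, l)] with [i] in [A]. *)
Lemma markov_walk_map k l (A : {fset D}) : (forall i, q k l i != 0 -> i \in A) ->
  walk_map (w := markov_walk) k (ketbra (e l) (e l)) = diag_op e A (q k l).
Proof.
move=> HA.
pose f (p : D * D) : V -> V := step_op (w := markov_walk) p.1 p.2 k \o
  ketbra (e l) (e l) \o adjoint (step_op (w := markov_walk) p.1 p.2 k).
have fE p v : f p v =
    (if p.2 == l then q k l p.1 else 0) *: ketbra (e p.1) (e p.1) v.
  exact: markov_summand.
have near_f : \forall F \near totally, partial_sum f F = diag_op e A (q k l).
  exists [fset (i, l) | i in A]%fset => // F /= AF.
  apply/funext => v; rewrite partial_sumE /diag_op.
  under eq_bigr do rewrite fE.
  rewrite -(big_fset_incl _ AF) /=; last first.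
    move=> [i j] _ /= nA; case: eqVneq => [jl|]; last by rewrite scale0r.
    rewrite (_ : q k l i = 0) ?scale0r //; apply: contraNeq nA => /HA iA.
    by apply/imfsetP; exists i => //=; rewrite jl.
  rewrite big_imfset /=; last by move=> i j _ _ [].
  by apply: eq_bigr => i _; rewrite eqxx.
have tS : trace_class (diag_op e A (q k l)).
  apply: diag_op_trace_class => //; [exact: orthonormal_on_delta|exact: l2_has_onb].
have : [set Y | trace_norm_sum f Y] (diag_op e A (q k l)) by exact: trace_norm_sum_near.
move=> /(xgetI (fun=> 0)) PX; apply/funext => v.
by apply: (trace_norm_sum_unique PX); apply: filterS near_f => F ->.
Qed.

Lemma markov_initial_map l :
  walk_map (w := markov_walk) l (ketbra (e (dzero D)) (e (dzero D))) =
  ketbra (e l) (e l).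
Proof.
rewrite (@markov_walk_map _ _ [fset l]%fset); last first.
  by move=> i; rewrite q_unit; apply: contraNT; rewrite inE => /negPf ->.
by apply/funext => v; rewrite /diag_op big_seq_fset1 q_unit eqxx scale1r.
Qed.

Lemma diag_op_block (A : {fset D}) (p : D -> C) : (forall i, 0 <= p i) ->
  (forall i, p i != 0 -> i \in A) ->
  block_diagonal (w := markov_walk) (diag_op e A p) (fun i h => p i *: h).
Proof.
move=> p0 pA; split=> [i|].
  rewrite [X in trace_class X](_ : _ =
    (fun h => p i *: ketbra (l2_delta tt) (l2_delta tt) h)).
    apply: rank_one_trace_class => //; first exact: l2_has_onb.
    by rewrite l2_delta_orthonormal eqxx.
  by apply/funext => h; rewrite /ketbra inner_delta -scalar_ofE.
apply: trace_norm_sum_near.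
  apply: diag_op_trace_class => //; [exact: orthonormal_on_delta|exact: l2_has_onb].
exists A => // F /= AF; apply/funext => v; rewrite partial_sumE /diag_op.
rewrite (eq_bigr (fun i => p i *: ketbra (e i) (e i) v)); last first.
  by move=> i _; rewrite /= scalar_tensor_op //; exact: bounded_op_ketbra.
rewrite (big_fset_incl _ AF) // => i _ iA.
by rewrite (_ : p i = 0) ?scale0r //; apply: contraNeq iA => /pA.
Qed.

(** On a one-dimensional coin each block is a scalar. Evaluating the block sum at [e m] retains only
    the block [m], whose scalar must then be [p m]. *)
Lemma blocks_diag_op (A : {fset D}) (p : D -> C) m : (forall i, 0 <= p i) ->
  (forall i, p i != 0 -> i \in A) ->
  blocks (w := markov_walk) (diag_op e A p) m = fun h => p m *: h.
Proof.
move=> p0 pA; rewrite /blocks.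
have := diag_op_block p0 pA => /(xgetI (fun _ _ => 0)).
set r := xget _ _ => -[rt rX].
(* A trace class block is bounded, in particular linear, so [coin_op_scalar] applies to the unknown
   [r m]. *)
have rl := (trace_class_bounded (rt m)).1.
rewrite (coin_op_scalar rl); apply/funext => h; congr (_ *: _).
set c := scalar_of _.
have := @trace_norm_sum_unique _ _ _ _ _ (e m) (c *: e m) rX.
have -> : diag_op e A p (e m) = p m *: e m.
  rewrite /diag_op (eq_bigr (fun i => (if i == m then p m else 0) *: e m)).
    rewrite -scaler_suml; congr (_ *: _).
    have [mA|mA] := boolP (m \in A).
      rewrite (big_fsetD1 m) //= eqxx big_seq big1 ?addr0 // => i.
      by rewrite in_fsetD1 => /andP[/negPf ->].
    rewrite big_seq big1 => [|i iA]; last first.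
      by case: eqVneq => // im; rewrite -im iA in mA.
    by apply/esym/eqP; apply: contraNT mA => /pA.
  move=> i _; rewrite /ketbra l2_delta_orthonormal.
  by case: eqVneq => [->|]; rewrite ?scale1r // !scale0r scaler0.
move=> H; have /(congr1 (inner (e m))) : p m *: e m = c *: e m.
  apply: H; exists [fset m]%fset => // F /=; rewrite fsub1set => mF.
  rewrite partial_sumE (big_fsetD1 m) //= big_seq big1 ?addr0 => [|i].
    rewrite (coin_op_scalar rl) /= scalar_tensor_op; last exact: bounded_op_ketbra.
    by rewrite /ketbra l2_delta_orthonormal eqxx scale1r.
  rewrite in_fsetD1 => /andP[im _].
  rewrite (coin_op_scalar (trace_class_bounded (rt i)).1).
  rewrite /= scalar_tensor_op; last exact: bounded_op_ketbra.
  by rewrite /ketbra l2_delta_orthonormal (negPf im) scale0r scaler0.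
by rewrite !innerZr l2_delta_orthonormal eqxx !mulr1.
Qed.

Lemma coin_trace (p : C) : trace (fun h : l2_space R unit => p *: h) = p.
Proof.
have d1 : inner (l2_delta tt) (l2_delta tt : l2_space R unit) = 1.
  by rewrite l2_delta_orthonormal eqxx.
rewrite -[RHS](rank_one_trace (@l2_has_onb R unit) p d1); congr trace.
by apply/funext => h; rewrite /ketbra inner_delta -scalar_ofE.
Qed.

Definition markov_state : V -> V := ketbra (e (dzero D)) (e (dzero D)).

Lemma markov_walk_prob k l m :
  walk_prob (w := markov_walk) markov_state k l m = q k l m.
Proof.
rewrite /walk_prob markov_initial_map; have [A HA] := q_fin k l.
by rewrite (markov_walk_map HA) blocks_diag_op // coin_trace.
Qed.

Lemma markov_initial_state : initial_state (w := markov_walk) markov_state.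
Proof.
have d1 : inner (e (dzero D)) (e (dzero D)) = 1 by rewrite l2_delta_orthonormal eqxx.
have E : markov_state = fun v => 1 *: ketbra (e (dzero D)) (e (dzero D)) v.
  by apply/funext => v; rewrite scale1r.
split; first split.
- by rewrite E; apply: rank_one_trace_class => //; exact: l2_has_onb.
- by rewrite E; exact: rank_one_positive.
- by rewrite E; apply: rank_one_trace => //; exact: l2_has_onb.
exists (fun i h => (i == dzero D)%:R *: h).
have -> : markov_state = diag_op e [fset dzero D]%fset (fun i => (i == dzero D)%:R).
  by apply/funext => v; rewrite /diag_op big_seq_fset1 eqxx scale1r.
apply: diag_op_block => i; first exact: ler0n.
by apply: contraNT; rewrite inE => /negPf ->.
Qed.

End markov_walk.

(** * Hypergroups *)

(* Locked, because unification is very slow when it can unfold the sum. *)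
HB.lock Definition relabel (R : realType) (X Y : choiceType) (f : X -> Y)
    (u : freevs R X) : freevs R Y :=
  \sum_(a <- monalg.msupp u) coef a u *: bas R (f a).

(** * Free vector spaces and relabelling of their bases *)

Section free_vector_spaces.
Context {R : realType}.
Local Notation C := R[i].

Section one_basis.
Context {X : choiceType}.
Implicit Types (u v : freevs R X) (a b : X).

Lemma coef_scalar a : scalar (coef a : freevs R X -> C).
Proof. by move=> c u v; rewrite /coef monalg.mcoeffD monalg.mcoeffZ. Qed.

HB.instance Definition _ a := GRing.isLinear.Build _ _ _ _
  (coef a : freevs R X -> C) (coef_scalar a).

Lemma coef_bas a b : coef a (bas R b) = (b == a)%:R.
Proof. by rewrite /coef monalg.mcoeffU. Qed.

Lemma freevs_ext u v : (forall a, coef a u = coef a v) -> u = v.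
Proof. by move=> uv; apply/monalg.malgP. Qed.

Lemma coef_supp u a : a \notin monalg.msupp u -> coef a u = 0.
Proof. exact: monalg.mcoeff_outdom. Qed.

Lemma freevsE u : u = \sum_(a <- monalg.msupp u) coef a u *: bas R a.
Proof.
rewrite {1}[u]monalg.monalgE; apply: eq_bigr => a _.
apply: freevs_ext => b; rewrite linearZ /= coef_bas /coef monalg.mcoeffU.
by rewrite mulr_natr.
Qed.

Lemma freevs_fsum u : u = \sum_(a \in [set: X]) coef a u *: bas R a.
Proof.
rewrite (fsbigTE (monalg.msupp u)); first exact: freevsE.
by move=> a /coef_supp ->; rewrite scale0r.
Qed.

(** The right-hand side has the shape of [walk_mul], with sums over the whole index set; they reduce
    to the finite supports of [u] and [v]. *)
Lemma bilinear_fsum (W : lmodType C) (b : freevs R X -> freevs R X -> W) u v :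
  (forall u', linear (b u')) -> (forall v', linear (b^~ v')) ->
  b u v = \sum_(i \in [set: X]) \sum_(j \in [set: X])
            (coef i u * coef j v) *: b (bas R i) (bas R j).
Proof.
move=> bl br.
transitivity (\sum_(i \in [set: X]) coef i u *: b (bas R i) v).
  rewrite {1}[u]freevsE (linearP_sum (br v)) (fsbigTE (monalg.msupp u)).
    by apply: eq_bigr => i _; rewrite (linearP_Z (br v)).
  by move=> i /coef_supp ->; rewrite scale0r.
apply: eq_fsbigr => i _.
rewrite {1}[v]freevsE (linearP_sum (bl _)) scaler_sumr (fsbigTE (monalg.msupp v)).
  by apply: eq_bigr => j _; rewrite (linearP_Z (bl _)) scalerA.
by move=> j /coef_supp ->; rewrite mulr0 scale0r.
Qed.

End one_basis.

Section relabelling.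
Context {X Y : choiceType}.
Implicit Types (f : X -> Y).

Lemma coef_relabel f g u b : cancel f g -> cancel g f ->
  coef b (relabel f u) = coef (g b) (u : freevs R X).
Proof.
move=> fK gK; rewrite {2}[u]freevsE relabel.unlock !linear_sum; apply: eq_bigr => a _.
by rewrite !linearZ /= !coef_bas -(can2_eq fK gK).
Qed.

Lemma relabel_linear f : bijective f -> linear (relabel f : freevs R X -> freevs R Y).
Proof.
move=> [g fK gK] c u v; apply: freevs_ext => b.
rewrite (coef_relabel _ _ fK gK) [LHS]coef_scalar [RHS]coef_scalar.
by congr (_ * _ + _); apply/esym/coef_relabel.
Qed.

Lemma relabel_bas f a : bijective f -> relabel f (bas R a) = bas R (f a) :> freevs R Y.
Proof.
move=> [g fK gK]; apply: freevs_ext => b.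
by rewrite (coef_relabel _ _ fK gK) !coef_bas -(can2_eq fK gK).
Qed.

End relabelling.

Lemma relabelK (X Y : choiceType) (f : X -> Y) (g : Y -> X) :
  cancel f g -> cancel g f -> cancel (relabel f : freevs R X -> _) (relabel g).
Proof.
move=> fK gK u; apply: freevs_ext => a.
by rewrite (coef_relabel _ _ gK fK) (coef_relabel _ _ fK gK) fK.
Qed.

End free_vector_spaces.

(** * The walk of a hypergroup and the transport of its structure *)

Section hypergroup_walk.
Context {R : realType} {I : distance_set} {X : choiceType}.
Local Notation C := R[i].
Variables (x : I -> X) (mul : freevs R X -> freevs R X -> freevs R X)
  (star : freevs R X -> freevs R X).
Hypothesis H : is_hypergroup x mul star.
Variable y : X -> I.
Hypotheses (xK : cancel x y) (yK : cancel y x).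

Local Notation q := (structure_constant x mul).
Let Hal := hg_algebra H.

Let x_bij : bijective x. Proof. by exists y. Qed.
Let y_bij : bijective y. Proof. by exists x. Qed.

Lemma finite_initial_segment (m : I) : finite_set [set j : I | (val j <= val m)%N].
Proof.
apply: (@finite_preimage _ _ `I_(val m).+1 (val : I -> nat)).
  by move=> i j _ _; exact: val_inj.
exact: finite_II.
Qed.

(** The weights given by [hg_convex] may be nonzero beyond the initial segment, where the structure
    constants vanish; hence the test [i \in B]. *)
Lemma structure_constant_convex k l : exists (B : {fset I}) (p : I -> R),
  [/\ forall i, 0 <= p i, \sum_(i <- B) p i = 1,
      mul (bas R (x k)) (bas R (x l)) = \sum_(i <- B) (p i)%:C *: bas R (x i) &
      forall i, q k l i = if i \in B then (p i)%:C else 0].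
Proof.
have [m [p [p0 p1 mulE]]] := hg_convex H k l.
have fS := finite_initial_segment m.
exists (fset_set [set j : I | (val j <= val m)%N]), p.
rewrite -!fsbig_finite //; split=> // i.
rewrite /structure_constant mulE fsbig_finite // linear_sum /=.
have E j : coef (x i) ((p j)%:C *: bas R (x j)) = (p j)%:C * (j == i)%:R.
  by rewrite linearZ /= coef_bas (inj_eq (can_inj xK)).
under eq_bigr do rewrite E.
case: ifPn => iB.
  rewrite (big_fsetD1 i) //= eqxx mulr1 big_seq big1 ?addr0 // => j.
  by rewrite in_fsetD1 => /andP[/negPf -> _]; rewrite mulr0.
rewrite big_seq big1 // => j jB; case: eqVneq => [ji|]; last by rewrite mulr0.
by rewrite -ji jB in iB.
Qed.

Lemma structure_constant_ge0 k l i : 0 <= q k l i.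
Proof.
have [B [p [p0 _ _ ->]]] := structure_constant_convex k l.
by case: ifP => _; rewrite ?ler0c.
Qed.

Lemma structure_constant_fin k l :
  exists A : {fset I}, forall i, q k l i != 0 -> i \in A.
Proof.
have [B [p [_ _ _ qE]]] := structure_constant_convex k l; exists B => i.
by rewrite qE; case: ifP => // _; rewrite eqxx.
Qed.

(** [A] and [B] both contain the support, so each sum equals the one over their union. *)
Lemma structure_constant_sum k l (A : {fset I}) :
  (forall i, q k l i != 0 -> i \in A) -> \sum_(i <- A) q k l i = 1.
Proof.
move=> HA; have [B [p [_ p1 _ qE]]] := structure_constant_convex k l.
transitivity (\sum_(i <- (A `|` B)%fset) q k l i).
  apply: (big_fset_incl _ (fsubsetUl A B)) => i _ iA.
  by apply/eqP; apply: contraNT iA => /HA.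
transitivity (\sum_(i <- B) q k l i).
  apply/esym/(big_fset_incl _ (fsubsetUr A B)) => i _ iB.
  by rewrite qE (negPf iB).
rewrite -[RHS](rmorph1 (real_complex R)) -p1 rmorph_sum /= big_seq [RHS]big_seq.
by apply: eq_bigr => i iB; rewrite qE iB.
Qed.

Lemma structure_constant_unit k i : q k (dzero I) i = (i == k)%:R.
Proof.
by rewrite /structure_constant (sa_one_r Hal) coef_bas (inj_eq (can_inj xK)) eq_sym.
Qed.

Definition hypergroup_oqrw : oqrw R I :=
  markov_walk structure_constant_ge0 structure_constant_fin structure_constant_sum.

Definition hypergroup_state : walk_space hypergroup_oqrw -> walk_space hypergroup_oqrw :=
  @markov_state R I.

Lemma hypergroup_walk_prob k l m : walk_prob hypergroup_state k l m = q k l m.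
Proof. exact: (markov_walk_prob _ _ _ structure_constant_unit). Qed.

Local Notation phi := (relabel y).
Local Notation psi := (relabel x).

Let phil : linear (phi : freevs R X -> _) := relabel_linear y_bij.
Let psil : linear (psi : freevs R I -> _) := relabel_linear x_bij.
Let phiK : cancel (phi : freevs R X -> _) psi := relabelK yK xK.
Let psiK : cancel (psi : freevs R I -> _) phi := relabelK xK yK.

(** Expanding the transported product over pairs of basis vectors, as [walk_mul] does by definition,
    leaves only basis products to compare, whose coefficients are the walk probabilities. The
    hypergroup axioms can then be transported along the labelling. *)
Lemma hypergroup_walk_mul u v :
  walk_mul hypergroup_state u v = phi (mul (psi u) (psi v)).
Proof.
rewrite [RHS](@bilinear_fsum _ _ _ (fun u v => phi (mul (psi u) (psi v)))).
- apply: eq_fsbigr => i _; apply: eq_fsbigr => j _; congr (_ *: _).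
  set w := RHS; have wE k : coef k w = q i j k.
    by rewrite /w (coef_relabel _ _ yK xK) (relabel_bas i x_bij) (relabel_bas j x_bij).
  rewrite [w]freevs_fsum; apply: eq_fsbigr => k _.
  by rewrite hypergroup_walk_prob wE.
- by move=> u' c v1 v2; rewrite psil (sa_linear_r Hal) phil.
- by move=> v' c u1 u2; rewrite psil (sa_linear_l Hal) phil.
Qed.

Lemma hypergroup_walk_mul_bas i j :
  walk_mul hypergroup_state (bas R i) (bas R j) =
  phi (mul (bas R (x i)) (bas R (x j))).
Proof. by rewrite hypergroup_walk_mul !relabel_bas. Qed.

Lemma hypergroup_walk_structure_constant i j k :
  structure_constant (@id I) (walk_mul hypergroup_state) i j k = q i j k.
Proof.
by rewrite /structure_constant hypergroup_walk_mul_bas (coef_relabel _ _ yK xK).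
Qed.

(** [produces] leaves the involution open; carrying over the given one covers the non-hermitian
    case. *)
Definition relabelled_star (u : freevs R I) : freevs R I := phi (star (psi u)).

Lemma relabelled_star_bas i : relabelled_star (bas R i) = phi (star (bas R (x i))).
Proof. by rewrite /relabelled_star relabel_bas. Qed.

Lemma hypergroup_walk_is_hypergroup :
  is_hypergroup (@id I) (walk_mul hypergroup_state) relabelled_star.
Proof.
split; first by exists id.
- apply/seteqP; split=> [_ [_ [i _ <-] <-]|_ [i _ <-]].
    rewrite relabelled_star_bas.
    have [h _ <-] : range (@bas R X) (star (bas R (x i))).
      by rewrite -(hg_star_onto H); exists (bas R (x i)) => //; exists (x i).
    by rewrite relabel_bas //; exists (y h).
  have [_ [h _ <-] hE] : (star @` range (@bas R X)) (bas R (x i)).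
    by rewrite (hg_star_onto H); exists (x i).
  exists (bas R (y h)); first by exists (y h).
  by rewrite relabelled_star_bas yK hE (relabel_bas (x i) y_bij) xK.
- split.
  + by move=> u c v w; rewrite !hypergroup_walk_mul psil (sa_linear_r Hal) phil.
  + by move=> v c u w; rewrite !hypergroup_walk_mul psil (sa_linear_l Hal) phil.
  + by move=> u v w; rewrite !hypergroup_walk_mul !phiK (sa_assoc Hal).
  + move=> u; rewrite hypergroup_walk_mul (relabel_bas _ x_bij).
    rewrite (sa_one_l Hal); exact: psiK.
  + move=> u; rewrite hypergroup_walk_mul (relabel_bas _ x_bij).
    rewrite (sa_one_r Hal); exact: psiK.
  + by move=> c u v; rewrite /relabelled_star psil (sa_conj Hal) phil.
  + by move=> u; rewrite /relabelled_star phiK (sa_invol Hal) psiK.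
  + move=> u v; rewrite /relabelled_star !hypergroup_walk_mul !phiK.
    by rewrite (sa_antimul Hal).
- move=> i j; have [m [p [p0 p1 mulE]]] := hg_convex H i j.
  have fS := finite_initial_segment m.
  exists m, p; split=> //; rewrite hypergroup_walk_mul_bas mulE !fsbig_finite //.
  rewrite (linearP_sum phil); apply: eq_bigr => k _.
  by rewrite (linearP_Z phil) (relabel_bas (x k) y_bij) xK.
- move=> i j; rewrite hypergroup_walk_structure_constant.
  rewrite (hg_inverse H) relabelled_star_bas.
  split=> [<-|E]; first by rewrite (relabel_bas (x i) y_bij) xK.
  by rewrite -[LHS]phiK (relabel_bas (x i) y_bij) xK E phiK.
Qed.

Lemma hypergroup_walk_produces : produces hypergroup_state relabelled_star.
Proof.
split; last exact: hypergroup_walk_is_hypergroup.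
move=> k l; have [A HA] := structure_constant_fin k l.
apply: (sub_finite_set _ (finite_fset A)) => m /=.
by rewrite hypergroup_walk_prob => /HA.
Qed.

Lemma hypergroup_walk_isomorphism :
  hypergroup_isomorphism mul star (walk_mul hypergroup_state) relabelled_star y.
Proof.
split=> //; exists phi; split=> // [h|u v|u]; first exact: relabel_bas.
  by rewrite hypergroup_walk_mul !phiK.
by rewrite /relabelled_star phiK.
Qed.

End hypergroup_walk.

Theorem theorem4p2 (R : realType) (I : distance_set) (X : choiceType)
    (x : I -> X) (mul : freevs R X -> freevs R X -> freevs R X)
    (star : freevs R X -> freevs R X) :
  is_hypergroup x mul star ->
  exists (w : oqrw R I) (rho0 : walk_space w -> walk_space w),
    initial_state rho0 /\
    exists star' : freevs R I -> freevs R I,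
      [/\ produces rho0 star',
          forall i j k : I,
            structure_constant (@id I) (walk_mul rho0) i j k =
            structure_constant x mul i j k &
          exists f : X -> I,
            hypergroup_isomorphism mul star (walk_mul rho0) star' f].
Proof.
move=> H; have [y xK yK] := hg_index H.
exists (hypergroup_oqrw H xK), (@hypergroup_state _ _ _ _ _ _ H _ xK).
split; first exact: markov_initial_state.
exists (relabelled_star x star y); split.
- exact: hypergroup_walk_produces.
- exact: hypergroup_walk_structure_constant.
- by exists y; exact: hypergroup_walk_isomorphism.
Qed.
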